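(* Let $\Bbbk$ be an infinite field, $S=\Bbbk[x_1,\ldots,x_n]$ with the standard grading, and let $I\subseteq S$ be a homogeneous ideal such that $\dim(S/I)\leq 1$. Assume that $I$ is generated by forms of degree at most $D$, and let $c=\operatorname{HF}(S/I;D)$. Then \[ \operatorname{reg}(S/I)\leq D+c-1. \]
   Context: For a finitely generated graded $S$-module $M=\bigoplus_{j\in\mathbb{Z}}M_j$, $\operatorname{HF}(M;j)=\dim_\Bbbk(M_j)$ is its Hilbert function. The Castelnuovo–Mumford regularity is $\operatorname{reg}(M)=\sup\{i+j \mid H^i_{\mathfrak m}(M)_j\neq 0\}$, where $\mathfrak m=(x_1,\ldots,x_n)$ and $H^i_{\mathfrak m}$ is graded local cohomology; equivalently $\operatorname{reg}(M)=\sup\{j-i\mid \operatorname{Tor}_i^S(\Bbbk,M)_j\neq 0\}$. $\dim$ denotes Krull dimension. *)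

(* Defs.v *)
From HB Require Import structures.
From mathcomp Require Import all_boot all_order all_algebra.
From mathcomp Require Import mpoly.
Set Implicit Arguments.
Unset Strict Implicit.
Unset Printing Implicit Defensive.
Import Order.TTheory GRing.Theory Num.Theory.
Local Open Scope ring_scope.

Section Defs.
Variables (k : fieldType) (n : nat).
Notation S := {mpoly k[n]}.

Definition is_ideal (I : S -> Prop) : Prop :=
  [/\ I 0, (forall f g, I f -> I g -> I (f + g)) & (forall f g, I g -> I (f * g))].

Definition homog_part (d : nat) (p : S) : S :=
  \sum_(m <- msupp p | mdeg m == d) p@_m *: 'X_[m].

Definition homogeneous_ideal (I : S -> Prop) : Prop :=
  is_ideal I /\ forall f d, I f -> I (homog_part d f).

Definition generated_by (I : S -> Prop) (G : seq S) : Prop :=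
  forall f, I f <-> exists h : 'I_(size G) -> S,
      f = \sum_(i < size G) h i * G`_i.

Definition generated_in_degrees_le (I : S -> Prop) (D : nat) : Prop :=
  exists G : seq S, generated_by I G /\
    forall g, g \in G -> exists d, (d <= D)%N /\ g \is d.-homog.

Definition prime_ideal (P : S -> Prop) : Prop :=
  [/\ is_ideal P, ~ P 1 & forall a b, P (a * b) -> P a \/ P b].

Definition strict_sub (P Q : S -> Prop) : Prop :=
  (forall f, P f -> Q f) /\ exists f, Q f /\ ~ P f.

(* Krull dimension of S/I is at most 1: no chain P0 < P1 < P2 of prime
   ideals of S containing I (primes of S/I correspond to primes over I). *)
Definition krull_dim_quot_le1 (I : S -> Prop) : Prop :=
  ~ exists P0 P1 P2 : S -> Prop,
      [/\ prime_ideal P0 /\ prime_ideal P1 /\ prime_ideal P2,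
          (forall f, I f -> P0 f), strict_sub P0 P1 & strict_sub P1 P2].

(* HF(S/I; d) = c : the k-vector space (S/I)_d = S_d / I_d has dimension c,
   i.e. it has a basis given by the classes of c forms of degree d. *)
Definition hilbert_fun_quot (I : S -> Prop) (d c : nat) : Prop :=
  exists f : 'I_c -> S,
    [/\ forall i, f i \is d.-homog,
        (forall lam : 'I_c -> k, I (\sum_i lam i *: f i) -> forall i, lam i = 0)
      & forall g, g \is d.-homog ->
          exists lam : 'I_c -> k, I (g - \sum_i lam i *: f i)].

(* A graded free resolution of S/I:
     ... -> F_2 --M 1--> F_1 --M 0--> F_0 = S -> S/I -> 0
   with F_i = (+)_{p < b i} S(- a i p) (row vectors, maps v |-> v *m M i),
   F_0 = S (b 0 = 1, a 0 _ = 0), graded (entries of M i homogeneous of the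
   right degrees) and exact.  It is minimal when all entries of the
   differentials lie in the homogeneous maximal ideal (zero constant term). *)
Definition minimal_graded_free_resolution (I : S -> Prop)
    (b : nat -> nat) (a : forall i, 'I_(b i) -> nat)
    (M : forall i, 'M[S]_(b i.+1, b i)) : Prop :=
  [/\ b 0%N = 1%N /\ (forall p : 'I_(b 0%N), a 0%N p = 0%N),
      (forall i (p : 'I_(b i.+1)) (q : 'I_(b i)),
          M i p q = 0 \/ ((a i q <= a i.+1 p)%N /\ M i p q \is (a i.+1 p - a i q)%N.-homog)),
      (forall f, I f <-> exists v : 'rV[S]_(b 1%N), forall q : 'I_(b 0%N), (v *m M 0%N) 0 q = f),
      (forall i (w : 'rV[S]_(b i.+1)),
          w *m M i = 0 <-> exists v : 'rV[S]_(b i.+2), v *m M i.+1 = w)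
    &
      (forall i p q, (M i p q)@_0%MM = 0)].

(* Tor_i^S(k, S/I)_j <> 0, computed from a minimal graded free resolution:
   dim_k Tor_i(k,S/I)_j is the number of summands S(-j) of F_i. *)
Definition tor_nonzero (I : S -> Prop) (i j : nat) : Prop :=
  exists b a M, @minimal_graded_free_resolution I b a M /\
    exists p : 'I_(b i), a i p = j.

Definition reg_quot_le (I : S -> Prop) (r : int) : Prop :=
  forall i j, tor_nonzero I i j -> (j%:Z - i%:Z <= r)%R.

End Defs.

(* Main.v *)
(** In degrees [>= D] the quotient [R = S/I] is a linearly presented module with [c]
    generators [w_q] (a basis of [R_D]): it is the [y]-linear part of [A/(f)], where
    [A = k[x,y]] and the [f_v] are the bilinear forms of the linear relations between the [w_q].
    Since [dim R <= 1] and [k] is infinite, some linear form [l] satisfies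
    [m^s <= I + (l)]; after a change of coordinates [l] is a variable.

    On a Koszul-type complex of the [f_v], cutting by variables one at a time
    relates the homology of consecutive sections by long exact sequences.  By induction, all
    homology modulo [l] of coefficient bidegree [(a, 1)], [a >= c], vanishes: multiplication
    by [x_i^s y_j] is injective on it and null-homotopic.  The same induction on
    the [y] variables lifts cycles of bidegree [(a, 0)] from [A/l] to [A].  Hence
    [l : R_(d-1) -> R_d] is onto and [l : R_d -> R_(d+1)] is injective for [d >= D + c].

    Finally, view the minimal resolution as one differential module graded by
    (internal degree) - (homological index).  In degree [d >= D + c] it is exact modulo [l]
    by the previous point, hence exact modulo all the variables; minimality then says
    that it has no generator there. *)
From HB Require Import structures.
Require Import Defs.
From mathcomp Require Import all_boot all_order all_algebra.
From mathcomp Require Import mpoly.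
From mathcomp Require Import ring zify.
From mathcomp Require boolp classical_sets.
Set Implicit Arguments.
Unset Strict Implicit.
Unset Printing Implicit Defensive.
Import GRing.Theory.
Local Open Scope ring_scope.

(** * Complexes cut by variables *)

Section Monomials.
Variables (k : fieldType) (N : nat).
Notation A := {mpoly k[N]}.

Definition msel (P : pred 'X_{1..N}) (p : A) : A :=
  \sum_(m <- msupp p | P m) p@_m *: 'X_[m].

Lemma mcoeff_msel P p m : (msel P p)@_m = if P m then p@_m else 0.
Proof.
rewrite raddf_sum /= (eq_bigr (fun m' => (m' == m)%:R * p@_m)); last first.
  by move=> m' _; rewrite mcoeffZ mcoeffX mulrC; case: eqP => [->|]; rewrite ?mul1r ?mul0r.
rewrite -mulr_suml; case: (boolP (m \in msupp p)) => [mp|mp]; last first.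
  by rewrite (memN_msupp_eq0 mp) mulr0 if_same.
rewrite -big_filter; case: ifPn => [Pm|Pm].
  rewrite (bigD1_seq m) /= ?mem_filter ?Pm ?filter_uniq ?msupp_uniq //.
  rewrite eqxx big1 ?addr0 ?mul1r // => i /negbTE ->; by [].
rewrite big_seq big1 ?mul0r // => i; rewrite mem_filter => /andP[Pi _].
by case: eqP Pi Pm => // -> ->.
Qed.

Definition mdiv (i : 'I_N) (p : A) : A :=
  \sum_(m <- msupp p | m i != 0%N) p@_m *: 'X_[m - U_(i)].

Lemma mcoeff_mdiv i p m : (mdiv i p)@_m = p@_(m + U_(i)).
Proof.
rewrite raddf_sum /= big_mkcond /=.
rewrite (eq_bigr (fun m' => (m' == m + U_(i))%MM%:R * p@_(m + U_(i))%MM)); last first.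
  move=> m' _; case: ifPn => [mi|/negPn/eqP mi].
    rewrite mcoeffZ mcoeffX mulrC.
    have -> : ((m' - U_(i))%MM == m) = (m' == (m + U_(i))%MM).
      rewrite -(eqm_add2r U_(i)%MM) submK //; by rewrite lep1mP.
    by case: eqP => [->|]; rewrite ?mul1r ?mul0r.
  case: eqP => [E|]; last by rewrite mul0r.
  by move: mi; rewrite E mnmDE mnm1E eqxx addn1.
rewrite -mulr_suml; case: (boolP ((m + U_(i))%MM \in msupp p)) => [mp|mp]; last first.
  by rewrite (memN_msupp_eq0 mp) mulr0.
rewrite (bigD1_seq _ mp) ?msupp_uniq //= eqxx big1 ?addr0 ?mul1r //.
by move=> j /negbTE ->.
Qed.

(** The ideal generated by the variables of [U], written as a condition on coefficients: a monomial
    ideal contains [p] exactly when it contains each monomial of [p]. Selecting monomials and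
    cancelling a variable outside [U] then preserve membership. *)
Definition var_ideal (U : {set 'I_N}) (p : A) : Prop :=
  forall m : 'X_{1..N}, (forall i, i \in U -> m i = 0%N) -> p@_m = 0.

Lemma var_ideal0 U : var_ideal U 0.
Proof. by move=> m _; rewrite mcoeff0. Qed.

Lemma var_idealD U p q : var_ideal U p -> var_ideal U q -> var_ideal U (p + q).
Proof. by move=> hp hq m hm; rewrite mcoeffD hp ?hq ?addr0. Qed.

Lemma var_idealN U p : var_ideal U p -> var_ideal U (- p).
Proof. by move=> hp m hm; rewrite mcoeffN hp ?oppr0. Qed.

Lemma var_idealB U p q : var_ideal U p -> var_ideal U q -> var_ideal U (p - q).
Proof. by move=> hp hq; apply/var_idealD/var_idealN. Qed.

Lemma var_idealMl U a p : var_ideal U p -> var_ideal U (a * p).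
Proof.
move=> hp m hm; rewrite mcoeffM big1 // => j /eqP E.
rewrite [X in _ * X]hp ?mulr0 // => i iU.
by have := congr1 (fun m' : 'X_{1..N} => m' i) E; rewrite mnmDE hm // => /esym/eqP; rewrite addn_eq0 => /andP[_ /eqP].
Qed.

Lemma var_idealMr U a p : var_ideal U p -> var_ideal U (p * a).
Proof. by rewrite mulrC; apply: var_idealMl. Qed.

Lemma var_ideal_sum U (J : Type) (r : seq J) (P : pred J) (F : J -> A) :
  (forall j, P j -> var_ideal U (F j)) -> var_ideal U (\sum_(j <- r | P j) F j).
Proof. by move=> h; elim/big_rec: _ => [|j x Pj hx]; [exact: var_ideal0 | apply: var_idealD (h _ Pj) hx]. Qed.

Lemma var_ideal_sub (U W : {set 'I_N}) p : U \subset W -> var_ideal U p -> var_ideal W p.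
Proof. by move=> /subsetP UW hp m hm; apply: hp => i /UW; apply: hm. Qed.

Lemma var_ideal_set0 p : var_ideal set0 p -> p = 0.
Proof. by move=> h; apply/mpolyP => m; rewrite mcoeff0; apply: h => i; rewrite inE. Qed.

Lemma var_idealX (U : {set 'I_N}) i : i \in U -> var_ideal U 'X_i.
Proof.
move=> iU m hm; rewrite mcoeffX; case: eqP => // E.
by have := hm _ iU; rewrite -E mnm1E eqxx.
Qed.

Lemma mcoeff_XM i (p : A) m : ('X_i * p)@_(m + U_(i)) = p@_m.
Proof. by rewrite mulrC addmC mcoeffMX. Qed.

Lemma var_ideal_cancel (U : {set 'I_N}) i p : i \notin U -> var_ideal U ('X_i * p) -> var_ideal U p.
Proof.
move=> iU h m hm; rewrite -(mcoeff_XM i); apply: h => j jU.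
rewrite mnmDE mnm1E hm //; case: eqP => // E; by rewrite E jU in iU.
Qed.

(** A monomial free of [U] either involves the variable [i], and then ['X_i * mdiv i p] reproduces
    its coefficient, or is free of [i |: U], and then both coefficients vanish. *)
Lemma var_ideal_mdiv (U : {set 'I_N}) i p :
  var_ideal (i |: U) p -> var_ideal U (p - 'X_i * mdiv i p).
Proof.
move=> h m hm; rewrite mcoeffB; case: (posnP (m i)) => [mi|mi].
  rewrite h ?sub0r; last by move=> j; rewrite !inE => /orP[/eqP -> //|]; apply: hm.
  rewrite (@var_idealMr [set i]) ?oppr0 //; first by apply: var_idealX; rewrite inE.
  by move=> j; rewrite inE => /eqP ->.
have -> : m = (m - U_(i) + U_(i))%MM by rewrite submK // lep1mP -lt0n.
by rewrite mcoeff_XM mcoeff_mdiv subrr.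
Qed.

Lemma msel_var_ideal P U p : var_ideal U p -> var_ideal U (msel P p).
Proof. by move=> h m hm; rewrite mcoeff_msel h // if_same. Qed.

End Monomials.

(** * Graded differential modules and their sections by variables *)

Section DifferentialModule.
Variables (k : fieldType) (N : nat) (G : zmodType).
Notation A := {mpoly k[N]}.
Variable wt : 'X_{1..N} -> G.
Hypothesis wtD : forall m1 m2, wt (m1 + m2)%MM = wt m1 + wt m2.
Variables (T : eqType) (rho : T -> G) (kappa : G) (L : T -> seq (T * A)).

(** [L t] is the finite list of matrix entries feeding the component [t], so chains may have
    infinite support. There is no homological index: [rho] grades the basis and [kappa] is the
    degree of the differential. *)
Definition bdry (u : T -> A) (t : T) : A := \sum_(x <- L t) u x.1 * x.2.
Definition homog_chain (d : G) (z : T -> A) : Prop :=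
  forall t m, (z t)@_m != 0 -> wt m + rho t = d.
Definition cycle_mod U (z : T -> A) : Prop := forall t, var_ideal U (bdry z t).
Definition bdry_mod U (z : T -> A) : Prop :=
  exists u, forall t, var_ideal U (z t - bdry u t).
Definition acyclic_mod U d : Prop :=
  forall z, homog_chain d z -> cycle_mod U z -> bdry_mod U z.

Hypothesis L_homog : forall t x, x \in L t ->
  forall m, x.2@_m != 0 -> wt m + rho t = rho x.1 + kappa.
Hypothesis bdry2 : forall u t, bdry (bdry u) t = 0.

Definition hpart (d : G) (z : T -> A) (t : T) : A :=
  msel (fun m => wt m + rho t == d) (z t).

Lemma hpart_homog d z : homog_chain d (hpart d z).
Proof. by move=> t m; rewrite mcoeff_msel; case: ifP => [/eqP //|]; rewrite eqxx. Qed.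

Lemma hpart_id d z : homog_chain d z -> hpart d z =1 z.
Proof.
move=> h t; apply/mpolyP => m; rewrite mcoeff_msel.
by case: ifPn => // /eqP ne; apply/eqP; rewrite eq_sym; apply/negPn/negP => /h.
Qed.

Lemma bdryB u v t : bdry (fun s => u s - v s) t = bdry u t - bdry v t.
Proof. by rewrite -sumrB /=; apply: eq_bigr => x _; rewrite mulrBl. Qed.

Lemma bdryM a u t : bdry (fun s => a * u s) t = a * bdry u t.
Proof. by rewrite mulr_sumr; apply: eq_bigr => x _; rewrite mulrA. Qed.

Lemma eq_bdry u v t : u =1 v -> bdry u t = bdry v t.
Proof. by move=> E; apply: eq_bigr => x _; rewrite E. Qed.

Lemma bdry_var_ideal U u t : (forall s, var_ideal U (u s)) -> var_ideal U (bdry u t).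
Proof. by move=> h; apply: var_ideal_sum => x _; apply: var_idealMr. Qed.

Lemma bdry_hpart d u t : bdry (hpart d u) t = hpart (d + kappa) (bdry u) t.
Proof.
apply/mpolyP => m; rewrite mcoeff_msel !raddf_sum /=.
have -> : (if wt m + rho t == d + kappa then \sum_(x <- L t) (u x.1 * x.2)@_m else 0)
   = \sum_(x <- L t) (if wt m + rho t == d + kappa then (u x.1 * x.2)@_m else 0).
  by case: ifP => // _; rewrite big1.
apply: eq_big_seq => x xL; rewrite !mcoeffM.
have -> : forall (b : bool) (s : k), (if b then s else 0) = b%:R * s.
  by case=> s; rewrite ?mul1r ?mul0r.
rewrite mulr_sumr; apply: eq_bigr => j /eqP E; rewrite mcoeff_msel.
have [->|nz] := eqVneq (x.2@_j.2) 0; first by rewrite !mulr0.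
have := L_homog xL nz; rewrite (congr1 wt E) wtD -addrA => ->.
rewrite addrA (inj_eq (addIr _)); case: ifP => _; by rewrite ?mul1r ?mul0r.
Qed.

Lemma bdry_homog d u : homog_chain d u -> homog_chain (d + kappa) (bdry u).
Proof.
move=> h t; rewrite (_ : bdry u t = hpart (d + kappa) (bdry u) t); first exact: hpart_homog.
by rewrite -bdry_hpart; apply: eq_bdry => s; rewrite hpart_id.
Qed.

(** A preimage may be taken homogeneous, because [hpart] commutes with the differential up to the
    shift [kappa] and preserves [var_ideal]. *)
Lemma bdry_mod_homog U d z u : homog_chain d z ->
  (forall t, var_ideal U (z t - bdry u t)) ->
  exists2 v, homog_chain (d - kappa) v & forall t, var_ideal U (z t - bdry v t).
Proof.
move=> hz hu; exists (hpart (d - kappa) u); first exact: hpart_homog.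
move=> t; rewrite bdry_hpart subrK -(hpart_id hz).
rewrite (_ : _ - _ = hpart d (fun s => z s - bdry u s) t); first exact: msel_var_ideal.
by apply/mpolyP => m; rewrite mcoeffB !mcoeff_msel mcoeffB; case: ifP; rewrite ?subr0.
Qed.

Lemma homog_XM d i z : homog_chain d z ->
  homog_chain (d + wt U_(i)) (fun t => 'X_i * z t).
Proof.
move=> hz t m nz.
have mi : m i != 0%N.
  apply/eqP => mi; move: nz; rewrite (@var_idealMr _ _ [set i]) ?eqxx //.
    by apply: var_idealX; rewrite inE.
  by move=> j; rewrite inE => /eqP ->.
have E : m = (m - U_(i) + U_(i))%MM by rewrite submK // lep1mP.
by move: nz; rewrite E mcoeff_XM => /hz <-; rewrite wtD addrAC.
Qed.

Lemma homog_mdiv d i z : homog_chain (d + wt U_(i)) z ->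
  homog_chain d (fun t => mdiv i (z t)).
Proof.
move=> hz t m; rewrite mcoeff_mdiv => /hz; rewrite wtD addrAC => /addIr; by [].
Qed.

Lemma homogB d u v : homog_chain d u -> homog_chain d v -> homog_chain d (fun t => u t - v t).
Proof.
move=> hu hv t m; rewrite mcoeffB => nz.
have [E|/hu //] := eqVneq ((u t)@_m) 0; apply: (hv t m).
by move: nz; rewrite E sub0r oppr_eq0.
Qed.

(* If the homology of C/(J_U + x_i) vanishes one step up, the long exact
   sequence of 0 -> C/J_U -> C/J_U -> C/(J_U + x_i) -> 0 makes multiplication by x_i injective. *)
Lemma section_injective (U : {set 'I_N}) i d z : i \notin U ->
  acyclic_mod (i |: U) (d + wt U_(i) - kappa) ->
  homog_chain d z -> bdry_mod U (fun t => 'X_i * z t) -> bdry_mod U z.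
Proof.
move=> iU ac hz [u0 hu0].
have [u hu hzu] := bdry_mod_homog (homog_XM (i := i) hz) hu0.
have sub : U \subset i |: U by apply: subsetUr.
have cu : cycle_mod (i |: U) u.
  move=> t; rewrite (_ : bdry u t = 'X_i * z t - ('X_i * z t - bdry u t)); last by rewrite subKr.
  apply: var_idealB; last exact: var_ideal_sub (hzu t).
  by apply/var_idealMr/var_idealX; rewrite !inE eqxx.
have [v hv] := ac _ hu cu.
(* Modulo [U], [u - bdry v] equals ['X_i * q]. Taking boundaries gives ['X_i * z = 'X_i * bdry q]
   modulo [U], and ['X_i] cancels. *)
pose q t := mdiv i (u t - bdry v t).
exists q => t; apply: (var_ideal_cancel iU).
have h1 : var_ideal U (bdry (fun s => (u s - bdry v s) - 'X_i * q s) t).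
  by apply: bdry_var_ideal => s; apply: var_ideal_mdiv.
move: h1; rewrite !bdryB bdryM bdry2 subr0 => h1.
by have := var_idealD (hzu t) h1; rewrite addrA subrK mulrBr.
Qed.

(** The boundary of a cycle [z] modulo [i |: U], divided by ['X_i], is a cycle [y] modulo [U]; if
    [v] bounds it, [z - 'X_i * v] is a cycle modulo [U]. The condition on [kappa] puts both cycles
    in degree [d], so acyclicity in this one degree serves twice. *)
Lemma section_acyclic (U : {set 'I_N}) i d : i \notin U ->
  kappa = wt U_(i) ->
  acyclic_mod U d -> acyclic_mod (i |: U) d.
Proof.
move=> iU kE ac z hz cz.
pose y t := mdiv i (bdry z t).
have hy : homog_chain d y by apply: homog_mdiv; rewrite -kE; apply: bdry_homog.
have zy t : var_ideal U (bdry z t - 'X_i * y t) by apply: var_ideal_mdiv.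
have cy : cycle_mod U y.
  move=> t; apply: (var_ideal_cancel iU).
  have := @bdry_var_ideal U (fun s => bdry z s - 'X_i * y s) t zy.
  by rewrite bdryB bdry2 sub0r bdryM => /var_idealN; rewrite opprK.
have [v0 hv0] := ac _ hy cy.
have [v hv hyv] := bdry_mod_homog hy hv0.
have cw : cycle_mod U (fun s => z s - 'X_i * v s).
  move=> t; rewrite bdryB bdryM.
  have := var_idealD (zy t) (var_idealMl 'X_i (hyv t)).
  by rewrite mulrBr addrA subrK.
have hw : homog_chain d (fun s => z s - 'X_i * v s).
  by apply: homogB => //; rewrite -(subrK kappa d) [in X in _ + X]kE; apply: homog_XM.
have [u hu] := ac _ hw cw.
exists u => t.
have := var_ideal_sub (subsetUr [set i] U) (hu t).
move/var_idealD => /(_ ('X_i * v t)).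
rewrite addrAC subrK; apply.
by apply/var_idealMr/var_idealX; rewrite !inE eqxx.
Qed.

(* The cycle-lifting property modulo x_l passes from U + x_i to U. *)
Lemma section_lift (U : {set 'I_N}) i l d : i \notin U -> l \notin U -> i != l ->
  acyclic_mod (l |: U) (d + wt U_(i)) ->
  (forall u, homog_chain (d + wt U_(i) - kappa) u -> cycle_mod (l |: (i |: U)) u ->
     exists u0, [/\ homog_chain (d + wt U_(i) - kappa) u0, cycle_mod (i |: U) u0 &
        bdry_mod (l |: (i |: U)) (fun t => u t - u0 t)]) ->
  (forall z, homog_chain d z -> cycle_mod (l |: U) z ->
     exists z0, [/\ homog_chain d z0, cycle_mod U z0 & bdry_mod (l |: U) (fun t => z t - z0 t)]).
Proof.
move=> iU lU il ac lift z hz cz.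
have ilU : i \notin l |: U by rewrite !inE negb_or il.
have hiz := homog_XM (i := i) hz.
have ciz : cycle_mod (l |: U) (fun t => 'X_i * z t).
  by move=> t; rewrite bdryM; apply/var_idealMl/cz.
have [u1 hu1] := ac _ hiz ciz.
have [u hu hzu] := bdry_mod_homog hiz hu1.
have cu : cycle_mod (l |: (i |: U)) u.
  move=> t; rewrite (_ : bdry u t = 'X_i * z t - ('X_i * z t - bdry u t)); last by rewrite subKr.
  apply: var_idealB; first by apply/var_idealMr/var_idealX; rewrite !inE eqxx orbT.
  by apply: var_ideal_sub (hzu t); apply: setUS; apply: subsetUr.
have [u0 [hu0 cu0 [v hv]]] := lift u hu cu.
(* The connecting map: the boundary of the cycle [u0] modulo [i |: U], divided by ['X_i], is a cycle
   modulo [U]. It replaces [z] because [u] and [u0] differ by a boundary modulo [l], [i] and [U]. *)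
pose z0 t := mdiv i (bdry u0 t).
have hz0 : homog_chain d z0 by apply: homog_mdiv; have := bdry_homog hu0; rewrite subrK.
have z0E t : var_ideal U (bdry u0 t - 'X_i * z0 t) by apply: var_ideal_mdiv.
exists z0; split=> //.
  move=> t; apply: (var_ideal_cancel iU).
  have := @bdry_var_ideal U (fun s => bdry u0 s - 'X_i * z0 s) t z0E.
  by rewrite bdryB bdry2 sub0r bdryM => /var_idealN; rewrite opprK.
pose r t := u t - u0 t - bdry v t.
pose q t := mdiv i (r t).
have rq t : var_ideal (l |: U) (r t - 'X_i * q t).
  by apply: var_ideal_mdiv; rewrite setUCA; apply: hv.
exists q => t; apply: (var_ideal_cancel ilU).
have h1 := @bdry_var_ideal (l |: U) (fun s => r s - 'X_i * q s) t rq.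
move: h1; rewrite bdryB bdryM /r !bdryB bdry2 subr0 => h1.
have h2 := var_ideal_sub (subsetUr [set l] U) (z0E t).
have := var_idealD (var_idealD (hzu t) h1) h2.
congr var_ideal; ring.
Qed.

End DifferentialModule.

(* A Koszul-type complex on unordered, possibly repeated, generators: a chain is a
   function on words in V, and bdry is the alternating sum over the positions where
   a letter v is inserted, weighted by f v.  Unlike with exterior powers,
   no sign bookkeeping is needed, and f v still acts null-homotopically. *)
Section WordComplex.
Variables (k : fieldType) (N : nat) (V : finType).
Notation A := {mpoly k[N]}.
Variable f : V -> A.

Fixpoint word_mx (t : seq V) : seq (seq V * A) :=
  [seq (v :: t, f v) | v <- enum V] ++
  (if t is a :: t' then [seq (a :: x.1, - x.2) | x <- word_mx t'] else [::]).

Notation bd := (bdry word_mx).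

Lemma word_bdryE u t : bd u t =
  \sum_v u (v :: t) * f v - (if t is a :: t' then bd (fun s => u (a :: s)) t' else 0).
Proof.
case: t => [|a t]; rewrite /bdry /= big_cat /= big_map big_enum /=; congr (_ + _).
  by rewrite big_nil oppr0.
by rewrite big_map -sumrN; apply: eq_bigr => x _; rewrite mulrN.
Qed.

(** Two insertions occur in both orders with opposite signs. The induction on the word separates
    insertions at the front, [eps], from those behind the first letter. *)
Lemma word_bdry2 u t : bd (bd u) t = 0.
Proof.
elim: t u => [|a t IH] u; rewrite word_bdryE.
  rewrite subr0.
  under eq_bigr => v _ do rewrite word_bdryE mulrBl.
  rewrite sumrB; apply/eqP; rewrite subr_eq0; apply/eqP.
  under [RHS]eq_bigr => v _ do rewrite word_bdryE subr0 mulr_suml.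
  rewrite [RHS]exchange_big /=; apply: eq_bigr => v _; rewrite mulr_suml.
  by apply: eq_bigr => w _; rewrite mulrAC.
pose eps (u : seq V -> A) t := \sum_v u (v :: t) * f v.
have E1 : \sum_v bd u [:: v, a & t] * f v =
  \sum_v eps u [:: v, a & t] * f v - bd (eps u) (a :: t).
  under eq_bigr => v _ do rewrite word_bdryE mulrBl.
  rewrite sumrB; congr (_ - _).
  rewrite /bdry; under [RHS]eq_bigr => x _ do rewrite mulr_suml.
  rewrite [RHS]exchange_big /=; apply: eq_bigr => v _; rewrite mulr_suml.
  by apply: eq_bigr => x _; rewrite mulrAC.
rewrite E1 word_bdryE.
have E2 : bd (fun s => bd u (a :: s)) t = bd (fun s => eps u (a :: s)) t.
  rewrite (@eq_bdry _ _ _ _ _ (fun s => eps u (a :: s) - bd (fun s' => u (a :: s')) s)); last first.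
    by move=> s; rewrite word_bdryE.
  by rewrite bdryB IH subr0.
rewrite E2 /eps; ring.
Qed.

Lemma word_mx_homog (G : zmodType) (wt : 'X_{1..N} -> G) kappa :
  (forall v m, (f v)@_m != 0 -> wt m = kappa) ->
  forall t x, x \in word_mx t -> forall m, x.2@_m != 0 -> wt m + 0 = 0 + kappa.
Proof.
move=> hf; elim=> [|a t IH] x /=; rewrite mem_cat => /orP[].
- by case/mapP => v _ -> m /= /hf ->; rewrite addrC.
- by [].
- by case/mapP => v _ -> m /= /hf ->; rewrite addrC.
- by case/mapP => y /IH h -> m /=; rewrite mcoeffN oppr_eq0 => /h.
Qed.

Definition word_unit (g : A) (t : seq V) : A := if t is [::] then g else 0.
Definition word_unit1 (h : V -> A) (t : seq V) : A := if t is [:: v] then h v else 0.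

Lemma word_bdry_nil u : bd u [::] = \sum_v u [:: v] * f v.
Proof. by rewrite word_bdryE subr0. Qed.

Lemma word_bdry_unit g t : bd (word_unit g) t = 0.
Proof.
rewrite word_bdryE big1 ?sub0r; last by move=> v _; rewrite mul0r.
by case: t => [|a t]; rewrite ?oppr0 // /bdry big1 ?oppr0 // => x _; rewrite mul0r.
Qed.

Lemma word_bdry_unit1 h t : bd (word_unit1 h) t = word_unit (\sum_v h v * f v) t.
Proof.
case: t => [|a [|b t]]; rewrite !word_bdryE /=.
- by rewrite subr0.
- by rewrite subr0 !big1 ?subr0 // => v _; rewrite /= mul0r.
rewrite !big1 => [|v _]; rewrite /= ?mul0r // ?sub0r.
by case: t => [|d t]; rewrite ?oppr0 // /bdry big1 ?oppr0 // => x _; rewrite mul0r.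
Qed.

Lemma word_bdry_var_ideal (U : {set 'I_N}) u t :
  (forall v, var_ideal U (f v)) -> var_ideal U (bd u t).
Proof.
move=> hf; elim: t u => [|a t IH] u; rewrite word_bdryE; apply: var_idealB;
  try exact: IH; try exact: var_ideal0; by apply: var_ideal_sum => v _; apply: var_idealMl.
Qed.

(** The homotopy [s] prepends a letter [v] with weight [h v]; then [bd s + s bd] is multiplication
    by the sum of the [h v * f v]. *)
Lemma word_null_homotopic (U : {set 'I_N}) g (h : V -> A) z :
  var_ideal U (g - \sum_v h v * f v) -> cycle_mod word_mx U z ->
  bdry_mod word_mx U (fun t => g * z t).
Proof.
move=> hg cz; exists (fun t => if t is v :: t' then h v * z t' else 0) => t.
rewrite word_bdryE; under eq_bigr => v _ do rewrite mulrAC.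
rewrite -mulr_suml opprB addrCA -mulrBl; apply: var_idealD; last exact: var_idealMr.
case: t => [|a t]; first exact: var_ideal0.
by rewrite bdryM; apply/var_idealMl/cz.
Qed.

End WordComplex.

(** * Bilinear forms *)

Section BilinearForms.
Variables (k : fieldType) (N : nat) (Y : {set 'I_N}) (V : finType).
Notation A := {mpoly k[N]}.
Variable f : V -> A.

(** The pair of x-degree and y-degree, with integer entries because the degrees of a differential
    module are taken in a group. *)
Definition bideg (m : 'X_{1..N}) : int * int :=
  ((\sum_(i | i \notin Y) m i)%N%:Z, (\sum_(i in Y) m i)%N%:Z).

Lemma bidegD m1 m2 : bideg (m1 + m2)%MM = bideg m1 + bideg m2.
Proof.
rewrite /bideg; under eq_bigr => i _ do rewrite mnmDE.
under [in X in (_, X)]eq_bigr => i _ do rewrite mnmDE.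
by rewrite !big_split /= !PoszD.
Qed.

Lemma bideg_x i : i \notin Y -> bideg U_(i) = (1, 0).
Proof.
move=> iY; congr (Posz _, Posz _).
  rewrite (bigD1 i) //= mnm1E eqxx big1 ?addn0 // => j /andP[_ ne].
  by rewrite mnm1E eq_sym (negbTE ne).
rewrite big1 // => j jY; rewrite mnm1E; case: eqP => // E.
by rewrite E jY in iY.
Qed.

Lemma bideg_y i : i \in Y -> bideg U_(i) = (0, 1).
Proof.
move=> iY; congr (Posz _, Posz _).
  rewrite big1 // => j jY; rewrite mnm1E; case: eqP => // E.
  by rewrite -E iY in jY.
rewrite (bigD1 i) //= mnm1E eqxx big1 ?addn0 // => j /andP[_ ne].
by rewrite mnm1E eq_sym (negbTE ne).
Qed.

Lemma homog_vanish_y (U : {set 'I_N}) (p : A) a b : Y \subset U ->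
  (forall m, p@_m != 0 -> bideg m = (a, b.+1%:Z)) -> var_ideal U p.
Proof.
move=> /subsetP YU h m hm; apply/eqP/negPn/negP => /h [_].
by rewrite big1 => [|i /YU/hm].
Qed.

Lemma homog_vanish_x (U : {set 'I_N}) (p : A) a b : ~: Y \subset U ->
  (forall m, p@_m != 0 -> bideg m = (a.+1%:Z, b)) -> var_ideal U p.
Proof.
move=> /subsetP YU h m hm; apply/eqP/negPn/negP => /h [].
by rewrite big1 => [|i iY] //; apply/hm/YU; rewrite inE.
Qed.

Hypothesis f_bilinear : forall v m, (f v)@_m != 0 -> bideg m = (1, 1).
Variable l : 'I_N.
Hypothesis lY : l \notin Y.
Hypothesis f_cofinite : forall i j, i \notin Y -> j \in Y ->
  exists s (h : V -> A), var_ideal [set l] ('X_i ^+ s * 'X_j - \sum_v h v * f v).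

Notation L := (word_mx f).
(* chains are graded by the bidegree of their coefficients, whatever the length of the word *)
Notation rho := (fun _ : seq V => 0 : int * int).
Notation kappa := (1%:Z, 1%:Z).

Let L_homog : forall t x, x \in L t -> forall m, x.2@_m != 0 -> bideg m + 0 = 0 + kappa.
Proof. exact: word_mx_homog. Qed.

Notation homg := (homog_chain bideg rho).

Lemma homog_chainP d (z : seq V -> A) : homg d z <-> forall t m, (z t)@_m != 0 -> bideg m = d.
Proof. by split=> h t m /h; rewrite addr0. Qed.

Let inj := section_injective bidegD L_homog (word_bdry2 f).

(** Induction on the number of variables outside [U]. If no y variable is left, y-degree 1 forces
    all coefficients into the ideal; if no x variable is left, positive x-degree does. Otherwise
    ['X_i ^+ s * 'X_j] is null-homotopic by [f_cofinite], and injective by induction. *)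
Lemma word_acyclic (U : {set 'I_N}) (a : nat) : l \in U -> (#|Y :\: U| <= a)%N ->
  acyclic_mod bideg rho L U (a%:Z, 1%:Z).
Proof.
have [s] := ubnP #|~: U|; elim: s U a => // s IH U a Us lU Ua z hz cz.
have triv : (forall t, var_ideal U (z t)) -> bdry_mod L U z.
  by move=> h; exists (fun _ => 0) => t; rewrite /bdry big1 ?subr0 // => x _; rewrite mul0r.
have /homog_chainP hz' := hz.
have [YU|/subsetPn[j jY jU]] := boolP (Y \subset U).
  by apply: triv => t; apply: (homog_vanish_y YU (hz' t)).
have Upos : (0 < #|Y :\: U|)%N by apply/card_gt0P; exists j; rewrite !inE jU.
case: a Ua hz hz' => [|a] Ua hz hz'; first by rewrite leqNgt Upos in Ua.
have [XU|/subsetPn[i]] := boolP (~: Y \subset U).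
  by apply: triv => t; apply: (homog_vanish_x XU (hz' t)).
rewrite inE => iY iU.
have small x : x \notin U -> (#|~: (x |: U)| < s)%N.
  move=> xU; apply: leq_trans (Us : (#|~: U| <= s)%N); apply: proper_card.
  apply/properP; split; first by rewrite setCS subsetUr.
  by exists x; rewrite !inE ?eqxx // xU.
have Ucy : (#|Y :\: (j |: U)| <= a)%N.
  rewrite -ltnS; apply: leq_trans Ua; apply: proper_card; apply/properP; split.
    by apply: setDS; apply: subsetUr.
  by exists j; rewrite !inE ?eqxx // jU jY.
have Ucx : (#|Y :\: (i |: U)| <= a.+1)%N.
  by apply: leq_trans Ua; apply/subset_leq_card/setDS/subsetUr.
(* multiplication by 'X_j, then repeatedly by 'X_i, is injective *)
apply: (inj jU _ hz).
  (* The section by ['X_j] is used in bidegree (a+1, 1) + (0, 1) - (1, 1) = (a, 1): the x-degree and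
     the number of remaining y variables drop together, which is why the bound counts y
     variables. *)
  rewrite (bideg_y jY) (_ : _ - _ = (a%:Z, 1%:Z)); last by congr (_, _); rewrite /=; lia.
  by apply: IH; rewrite ?small // inE lU orbT.
have [e [h hh]] := f_cofinite iY jY.
have cyc b : cycle_mod L U (fun t => 'X_i ^+ b * ('X_j * z t)).
  by move=> t; rewrite !bdryM; do 2!apply: var_idealMl; apply: cz.
have hom b : homg ((a.+1 + b)%N%:Z, 2%:Z) (fun t => 'X_i ^+ b * ('X_j * z t)).
  elim: b => [|b IHb].
    apply/homog_chainP => t m; rewrite expr0 mul1r addn0.
    move/(homog_XM bidegD hz); rewrite addr0 => ->.
    by rewrite (bideg_y jY); congr (_, _); rewrite /=; lia.
  apply/homog_chainP => t m; rewrite exprS -mulrA.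
  move/(homog_XM bidegD IHb); rewrite addr0 => ->.
  by rewrite (bideg_x iY); congr (_, _); rewrite /=; lia.
have down b : bdry_mod L U (fun t => 'X_i ^+ b * ('X_j * z t)) ->
    bdry_mod L U (fun t => 'X_j * z t).
  elim: b => [[u hu]|b IHb [u hu]]; first by exists u => t; have := hu t; rewrite expr0 mul1r.
  apply: IHb; apply: (inj iU _ (hom b)).
    (* After multiplication by ['X_j] the y-degree is 2, so the section by ['X_i] is needed in
       y-degree 1, where the induction applies. *)
    rewrite (bideg_x iY) (_ : _ - _ = ((a.+1 + b)%N%:Z, 1%:Z)); last by congr (_, _); rewrite /=; lia.
    apply: IH; rewrite ?small //; first by rewrite inE lU orbT.
    by apply: leq_trans Ucx _; apply: leq_addr.
  by exists u => t; have := hu t; rewrite exprS -mulrA.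
apply: (down e).
have hU : var_ideal U ('X_i ^+ e * 'X_j - \sum_v h v * f v).
  by apply: var_ideal_sub hh; rewrite sub1set.
have [u hu] := word_null_homotopic hU cz.
by exists u => t; have := hu t; rewrite mulrA.
Qed.

(** If [U] contains every y variable, all [f v] vanish modulo [U], every chain is a cycle and [z]
    lifts itself. Otherwise [section_lift] cuts by some ['X_j]: it calls [word_acyclic] in bidegree
    (a+1, 1) and the induction in bidegree (a, 0). *)
Lemma word_lift (U : {set 'I_N}) (a : nat) : U \subset Y -> (#|Y :\: U| <= a)%N ->
  forall z, homg (a%:Z, 0) z -> cycle_mod L (l |: U) z ->
  exists z0, [/\ homg (a%:Z, 0) z0, cycle_mod L U z0 & bdry_mod L (l |: U) (fun t => z t - z0 t)].
Proof.
have [s] := ubnP #|Y :\: U|; elim: s U a => // s IH U a Us UY Ua z hz cz.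
have [YU|/subsetPn[j jY jU]] := boolP (Y \subset U).
  exists z; split=> //; last first.
    exists (fun _ => 0) => t; rewrite subrr /bdry big1 ?subr0; first exact: var_ideal0.
    by move=> x _; rewrite mul0r.
  move=> t; apply: word_bdry_var_ideal => v.
  exact: (@homog_vanish_y U (f v) 1 0 YU (@f_bilinear v)).
have jl : j != l by apply: contraNneq lY => <-.
have lU : l \notin U by apply: contraNN lY; apply: (subsetP UY).
have Upos : (0 < #|Y :\: U|)%N by apply/card_gt0P; exists j; rewrite !inE jU.
case: a Ua hz => [|a] Ua hz; first by rewrite leqNgt Upos in Ua.
have lt : (#|Y :\: (j |: U)| < #|Y :\: U|)%N.
  apply: proper_card; apply/properP; split; first by apply: setDS; apply: subsetUr.
  by exists j; rewrite !inE ?eqxx // jU jY.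
have E1 : (a.+1%:Z, 0) + bideg U_(j) = (a.+1%:Z, 1%:Z).
  by rewrite (bideg_y jY); congr (_, _); rewrite /=; lia.
have E2 : (a.+1%:Z, 0) + bideg U_(j) - kappa = (a%:Z, 0).
  by rewrite E1; congr (_, _); rewrite /=; lia.
apply: (section_lift bidegD L_homog (word_bdry2 f) jU lU jl _ _ hz cz).
  rewrite E1; apply: word_acyclic; first by rewrite !inE eqxx.
  by apply: leq_trans Ua; apply/subset_leq_card/setDS/subsetUr.
rewrite E2; apply: IH.
- exact: leq_trans lt Us.
- by rewrite subUset sub1set jY.
- by rewrite -ltnS; apply: leq_trans lt Ua.
Qed.

Definition f_span (g : A) := exists h : V -> A, g = \sum_v h v * f v.

Lemma homog_word_unit a b g : (forall m, g@_m != 0 -> bideg m = (a, b)) ->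
  homg (a, b) (word_unit g : seq V -> A).
Proof. by move=> h; apply/homog_chainP => -[|? ?] m //=; [apply: h|rewrite mcoeff0 eqxx]. Qed.

(** Placed on the empty word, [g] is a cycle; a chain bounding it modulo ['X_l] gives, on one-letter
    words, the coefficients of the [f v]. *)
Lemma f_span_mod_l (a : nat) g : (#|Y| <= a)%N ->
  (forall m, g@_m != 0 -> bideg m = (a%:Z, 1%:Z)) ->
  exists g', f_span (g - 'X_l * g').
Proof.
move=> Ya /homog_word_unit hg.
have [|||u hu] := @word_acyclic [set l] a _ _ (word_unit g) hg.
- by rewrite inE.
- by apply: leq_trans Ya; apply/subset_leq_card/subsetDl.
- by move=> t; rewrite word_bdry_unit; apply: var_ideal0.
have := hu [::]; rewrite word_bdry_nil /= -(setU0 [set l]) => /var_ideal_mdiv/var_ideal_set0.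
set g' := mdiv _ _ => E; exists g', (fun v => u [:: v]).
by apply/eqP; rewrite -subr_eq0 addrAC E.
Qed.

(** The relation for ['X_l * g] is a chain [u] of bidegree (a, 0) that is a cycle modulo ['X_l].
    Once a genuine cycle from [word_lift] and a boundary are subtracted, [u] is divisible by ['X_l],
    and the quotient expresses [g]. *)
Lemma f_span_cancel_l (a : nat) g : (#|Y| <= a)%N ->
  (forall m, g@_m != 0 -> bideg m = (a%:Z, 1%:Z)) ->
  f_span ('X_l * g) -> f_span g.
Proof.
move=> Ya /homog_word_unit hg [h hh].
have hb : forall t, var_ideal set0 ('X_l * word_unit g t - bdry L (word_unit1 h) t).
  move=> t; rewrite word_bdry_unit1 -hh.
  by case: t => [|v t] /=; rewrite ?mulr0 ?subrr; apply: var_ideal0.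
have hlg := homog_XM bidegD (i := l) hg.
have [u hu hzu] := bdry_mod_homog bidegD L_homog hlg hb.
have E : (a%:Z, 1%:Z) + bideg U_(l) - kappa = (a%:Z, 0).
  by rewrite (bideg_x lY); congr (_, _); rewrite /=; lia.
rewrite E in hu.
have zu t : 'X_l * word_unit g t = bdry L u t.
  by apply/eqP; rewrite -subr_eq0; apply/eqP/var_ideal_set0/hzu.
have cu : cycle_mod L (l |: set0) u.
  move=> t; rewrite -zu; apply/var_idealMr/var_idealX; rewrite !inE eqxx //.
have [|u0 [hu0 cu0 [v hv]]] := @word_lift set0 a (sub0set _) _ u hu cu.
  by rewrite setD0.
pose q t := mdiv l (u t - u0 t - bdry L v t).
have Eq t : u t - u0 t - bdry L v t = 'X_l * q t.
  by apply/eqP; rewrite -subr_eq0; apply/eqP/var_ideal_set0/var_ideal_mdiv.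
have bu0 t : bdry L u0 t = 0 by apply/var_ideal_set0/cu0.
have key : bdry L u [::] = 'X_l * bdry L q [::].
  rewrite -bdryM -(eq_bdry _ _ Eq) !bdryB word_bdry2 bu0 !subr0 //.
move: key; rewrite -zu /= => /mulfI -> //; last first.
  by rewrite -msize_poly_eq0 msizeX.
by exists (fun v => q [:: v]); rewrite word_bdry_nil.
Qed.

End BilinearForms.

(** * The truncated quotient ring *)

Section Ideals.
Variables (k : fieldType) (n : nat) (I : {mpoly k[n]} -> Prop).
Hypothesis idI : is_ideal I.

Lemma is_ideal0 : I 0. Proof. by case: idI. Qed.
Lemma is_idealD f g : I f -> I g -> I (f + g). Proof. by case: idI => _ h _; apply: h. Qed.
Lemma is_idealMl f g : I g -> I (f * g). Proof. by case: idI => _ _ h; apply: h. Qed.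
Lemma is_idealMr f g : I g -> I (g * f). Proof. by rewrite mulrC; apply: is_idealMl. Qed.
Lemma is_idealN f : I f -> I (- f). Proof. by rewrite -mulN1r; apply: is_idealMl. Qed.
Lemma is_idealB f g : I f -> I g -> I (f - g).
Proof. by move=> hf hg; apply/is_idealD/is_idealN. Qed.
Lemma is_idealZ a f : I f -> I (a *: f). Proof. by rewrite -mul_mpolyC; apply: is_idealMl. Qed.
Lemma is_ideal_sum (J : Type) (r : seq J) (P : pred J) F :
  (forall j, P j -> I (F j)) -> I (\sum_(j <- r | P j) F j).
Proof. by move=> h; elim/big_rec: _ => [|j x Pj]; [exact: is_ideal0 | apply/is_idealD/h]. Qed.
Lemma is_ideal_congr f g : I (f - g) -> I f -> I g.
Proof. by move=> h hf; rewrite -(subKr f g); apply: is_idealB. Qed.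

End Ideals.

Section HomogeneousParts.
Variables (k : fieldType) (n : nat).
Notation S := {mpoly k[n]}.

Lemma mcoeff_pihomog d (p : S) m : (pihomog mdeg d p)@_m = if mdeg m == d then p@_m else 0.
Proof. exact: (mcoeff_msel (fun m => mdeg m == d)). Qed.

Lemma pihomog_0 (p : S) : pihomog mdeg 0 p = (p@_0%MM)%:MP.
Proof.
apply/mpolyP => m; rewrite mcoeff_pihomog mcoeffC mdeg_eq0.
by case: eqP => [->|]; rewrite ?mulr1 ?mulr0.
Qed.

Lemma pihomog_mul_gen d e (h g : S) : g \is e.-homog ->
  pihomog mdeg d (h * g) = \sum_(M <- msupp h | (mdeg M + e)%N == d) h@_M *: ('X_[M] * g).
Proof.
move=> hg; rewrite {1}[h]mpolyE mulr_suml linear_sum [RHS]big_mkcond /=.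
apply: eq_bigr => M _; rewrite -scalerAl linearZ /=.
have hMg : 'X_[M] * g \is (mdeg M + e).-homog by apply: dhomogM hg; rewrite dhomogX.
case: eqP => [<-|/eqP ne]; first by rewrite pihomog_dE.
by rewrite (pihomog_ne0 _ hMg) ?scaler0 // eq_sym.
Qed.

Lemma pihomog_mul_linear d (l g : S) : l \is 1.-homog ->
  pihomog mdeg d.+1 (l * g) = l * pihomog mdeg d g.
Proof.
move=> hl; rewrite mulrC (pihomog_mul_gen _ _ hl) pihomogE mulr_sumr.
by apply: eq_big => [M|M _]; rewrite ?addn1 ?eqSS // -scalerAr mulrC.
Qed.

End HomogeneousParts.

Section MonomialDivisors.
Variable n : nat.
Implicit Types M u : 'X_{1..n}.

(** Some divisor of degree [t], grown one variable at a time. Any other choice would do: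
    [span_exchange] compares all factorisations. *)
Fixpoint mdivisor (t : nat) M : 'X_{1..n} :=
  if t is t'.+1 then
    if [pick i | (M - mdivisor t' M)%MM i != 0%N] is Some i then (mdivisor t' M + U_(i))%MM
    else mdivisor t' M
  else 0%MM.

Lemma mdivisorP t M : (t <= mdeg M)%N -> (mdivisor t M <= M)%MM /\ mdeg (mdivisor t M) = t.
Proof.
elim: t => [|t IH] tM /=; first by rewrite mdeg0; split=> //; apply/mnm_lepP => i; rewrite mnm0E.
have [le dE] := IH (ltnW tM); case: pickP => [i|none].
  rewrite mnmBE => hi; rewrite mdegD dE mdeg1 addn1; split=> //.
  apply/mnm_lepP => j; have := mnm_lepP le j; rewrite mnmDE mnm1E.
  by have [<-|_] := eqVneq i j; move: hi => /=; lia.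
have E : M = mdivisor t M.
  apply/mnmP => j; have := none j; rewrite mnmBE => /negbFE/eqP.
  by have := mnm_lepP le j; lia.
by move: tM; rewrite {1}E dE ltnn.
Qed.

Lemma mdivisorK t M : (t <= mdeg M)%N -> (mdivisor t M + (M - mdivisor t M) = M)%MM.
Proof. by move=> /mdivisorP[le _]; rewrite addmC submK. Qed.

Lemma mdeg_mdivisor t M : (t <= mdeg M)%N -> mdeg (mdivisor t M) = t.
Proof. by case/mdivisorP. Qed.

Lemma mdeg_codivisor t M : (t <= mdeg M)%N -> mdeg (M - mdivisor t M) = (mdeg M - t)%N.
Proof.
by move=> h; have := congr1 mdeg (mdivisorK h); rewrite mdegD mdeg_mdivisor //; lia.
Qed.

End MonomialDivisors.

(** * Linear presentation of the quotient in degrees at least D *)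

Section LinearPresentation.
Variables (k : fieldType) (n : nat) (I : {mpoly k[n]} -> Prop) (D c : nat).
Notation S := {mpoly k[n]}.
Notation A := {mpoly k[n + c]}.
Hypothesis idI : is_ideal I.
Variable gens : seq S.
Hypothesis gensI : generated_by I gens.
Hypothesis gens_deg : forall g, g \in gens -> exists d, (d <= D)%N /\ g \is d.-homog.
Variable w : 'I_c -> S.
Hypothesis w_homog : forall q, w q \is D.-homog.
Hypothesis w_free : forall lam : 'I_c -> k, I (\sum_i lam i *: w i) -> forall i, lam i = 0.
Hypothesis w_span : forall g, g \is D.-homog -> exists lam : 'I_c -> k, I (g - \sum_i lam i *: w i).

Definition xemb : S -> A := comp_mpoly [tuple 'X_(lshift c i) | i < n].
Definition yvar (q : 'I_c) : A := 'X_(rshift n q).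
Definition yset : {set 'I_(n + c)} := [set rshift n q | q in 'I_c].
Definition theta : A -> S :=
  comp_mpoly [tuple (match split i with inl a => 'X_a | inr q => w q end) | i < n + c].

HB.instance Definition _ := GRing.RMorphism.on xemb.
HB.instance Definition _ := GRing.RMorphism.on theta.

Lemma xembZ a p : xemb (a *: p) = a *: xemb p. Proof. exact: comp_mpolyZ. Qed.
Lemma thetaZ a p : theta (a *: p) = a *: theta p. Proof. exact: comp_mpolyZ. Qed.

Lemma xembX i : xemb 'X_i = 'X_(lshift c i).
Proof. by rewrite /xemb comp_mpolyXU -tnth_nth tnth_mktuple. Qed.

Lemma theta_y q : theta (yvar q) = w q.
Proof. by rewrite /theta comp_mpolyXU -tnth_nth tnth_mktuple (unsplitK (inr _ q)). Qed.

Lemma theta_xX i : theta 'X_(lshift c i) = 'X_i.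
Proof. by rewrite /theta comp_mpolyXU -tnth_nth tnth_mktuple (unsplitK (inl _ i)). Qed.

Lemma theta_xemb p : theta (xemb p) = p.
Proof.
rewrite {1 2}[p]mpolyE (rmorph_sum xemb) (rmorph_sum theta); apply: eq_bigr => m _ /=.
rewrite xembZ thetaZ; congr (_ *: _).
rewrite /xemb comp_mpolyX rmorph_prod /= mpolyXE_id; apply: eq_bigr => i _.
by rewrite rmorphXn /= tnth_mktuple theta_xX.
Qed.

Notation xydeg := (bideg yset).
Definition bihom (d : int * int) (p : A) := forall m, p@_m != 0 -> xydeg m = d.

Lemma bihom_sum (J : Type) (r : seq J) (P : pred J) (F : J -> A) d :
  (forall j, P j -> bihom d (F j)) -> bihom d (\sum_(j <- r | P j) F j).
Proof.
move=> h; elim/big_rec: _ => [|j x Pj hx] m; first by rewrite mcoeff0 eqxx.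
rewrite mcoeffD; have [->|/(h _ Pj) //] := eqVneq ((F j)@_m) 0.
by rewrite add0r => /hx.
Qed.

Lemma bihomZ a p d : bihom d p -> bihom d (a *: p).
Proof. by move=> h m; rewrite mcoeffZ mulf_eq0 negb_or => /andP[_ /h]. Qed.

Lemma bihomN p d : bihom d p -> bihom d (- p).
Proof. by rewrite -scaleN1r; apply: bihomZ. Qed.

Lemma bihomD p q d : bihom d p -> bihom d q -> bihom d (p + q).
Proof.
move=> hp hq m; rewrite mcoeffD; have [->|/hp //] := eqVneq (p@_m) 0.
by rewrite add0r => /hq.
Qed.

Lemma bihomM p q d e : bihom d p -> bihom e q -> bihom (d + e) (p * q).
Proof.
move=> hp hq m; rewrite -mcoeff_msupp => /msuppM_le/allpairsP[[m1 m2] /= [h1 h2 ->]].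
by rewrite bidegD hp ?hq // -mcoeff_msupp.
Qed.

Lemma bihomX i : bihom (xydeg U_(i)) 'X_i.
Proof. by move=> m; rewrite mcoeffX; case: (_ =P m) => [->|] //; rewrite eqxx. Qed.

Lemma lshift_yset i : lshift c i \notin yset.
Proof. by apply/imsetP => -[q _ /eqP]; rewrite eq_lrshift. Qed.

Lemma rshift_yset q : rshift n q \in yset.
Proof. exact: imset_f. Qed.

Lemma card_yset : #|yset| = c.
Proof. by rewrite card_imset ?card_ord //; apply: rshift_inj. Qed.

Lemma bihom_yvar q : bihom (0, 1) (yvar q).
Proof. by have := @bihomX (rshift n q); rewrite (bideg_y (rshift_yset q)). Qed.

Lemma bihom_xX i : bihom (1, 0) 'X_(lshift c i).
Proof. by have := @bihomX (lshift c i); rewrite (bideg_x (lshift_yset i)). Qed.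

Lemma bihom_xembX (M : 'X_{1..n}) : bihom ((mdeg M)%:Z, 0) (xemb 'X_[M]).
Proof.
have [d] := ubnP (mdeg M); elim: d M => // d IH M /= Md.
have [M0|] := eqVneq M 0%MM.
  rewrite M0 mpolyX0 rmorph1 mdeg0 => m; rewrite mcoeff1; case: (m =P _) => [-> _|]; last by rewrite eqxx.
  by rewrite /bideg !big1 // => i _; rewrite mnm0E.
move=> M0; have [i hi] : exists i, M i != 0%N.
  apply/existsP; apply: contraNT M0 => /existsPn h; apply/eqP/mnmP => i.
  by rewrite mnm0E; apply/eqP/negPn/h.
have E : M = (M - U_(i) + U_(i))%MM by rewrite submK // lep1mP.
have dE : mdeg M = (mdeg (M - U_(i))).+1 by rewrite {1}E mdegD mdeg1 addn1.
rewrite {2}E mpolyXD rmorphM /= xembX.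
have -> : ((mdeg M)%:Z, 0 : int) = ((mdeg (M - U_(i))%MM)%:Z, 0 : int) + (1, 0 : int).
  by rewrite dE; apply: (congr2 pair) => /=; lia.
by apply: bihomM (@bihom_xX i); apply: IH; rewrite -ltnS -dE.
Qed.

Lemma bihom_xemb t p : p \is t.-homog -> bihom (t%:Z, 0) (xemb p).
Proof.
move=> hp; rewrite [p]mpolyE (rmorph_sum xemb) /= big_seq; apply: bihom_sum => m mp.
by rewrite xembZ; apply: bihomZ; have <- := dhomogP _ _ _ hp m mp; apply: bihom_xembX.
Qed.

Lemma nf_exists : exists lam : 'X_{1..n} -> 'I_c -> k,
  forall m, mdeg m = D -> I ('X_[m] - \sum_i lam m i *: w i).
Proof.
suff /boolp.choice[f hf] : forall m, exists l : 'I_c -> k, mdeg m = D -> I ('X_[m] - \sum_i l i *: w i) by exists f.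
move=> m.
have [mD|/eqP mD] := eqVneq (mdeg m) D; last by exists (fun _ => 0).
have [|l hl] := @w_span 'X_[m]; first by rewrite dhomogX /= mD.
by exists l.
Qed.

Variable lam : 'X_{1..n} -> 'I_c -> k.
Hypothesis lamP : forall m, mdeg m = D -> I ('X_[m] - \sum_i lam m i *: w i).

Definition nf m : A := \sum_q lam m q *: yvar q.

(** The index (p, (i, j)) stands for the syzygy x_i (x_j p) = x_j (x_i p), rewritten with normal
    forms of the monomials of degree [D]. The bound on p makes the index type finite; an index with
    p of degree other than D - 1 yields the zero relation. *)
Definition rel_type := ('X_{1..n < D} * ('I_n * 'I_n))%type.
Definition lin_rel (v : rel_type) : A :=
  if (mdeg v.1).+1 == D then
    'X_(lshift c v.2.1) * nf (v.1 + U_(v.2.2)) - 'X_(lshift c v.2.2) * nf (v.1 + U_(v.2.1))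
  else 0.

Notation span := (f_span lin_rel).

Lemma span0 : span 0.
Proof. by exists (fun _ => 0); rewrite big1 // => v _; rewrite mul0r. Qed.

Lemma spanD a b : span a -> span b -> span (a + b).
Proof.
move=> [h ->] [h' ->]; exists (fun v => h v + h' v).
by rewrite -big_split; apply: eq_bigr => v _; rewrite mulrDl.
Qed.

Lemma spanMl a b : span b -> span (a * b).
Proof.
move=> [h ->]; exists (fun v => a * h v).
by rewrite mulr_sumr; apply: eq_bigr => v _; rewrite mulrA.
Qed.

Lemma spanN a : span a -> span (- a).
Proof. by rewrite -mulN1r; apply: spanMl. Qed.

Lemma spanZ a b : span b -> span (a *: b).
Proof. by rewrite -mul_mpolyC; apply: spanMl. Qed.

Lemma span_sum (J : Type) (r : seq J) (P : pred J) F :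
  (forall j, P j -> span (F j)) -> span (\sum_(j <- r | P j) F j).
Proof. by move=> h; elim/big_rec: _ => [|j x Pj]; [exact: span0 | apply/spanD/h]. Qed.

Lemma span_rel v : span (lin_rel v).
Proof.
exists (fun v' => (v' == v)%:R); rewrite (bigD1 v) //= eqxx mul1r big1 ?addr0 // => v' /negbTE ->.
by rewrite mul0r.
Qed.

Lemma bihom_nf m : bihom (0, 1) (nf m).
Proof. by apply: bihom_sum => q _; apply/bihomZ/bihom_yvar. Qed.

Lemma lin_rel_bilinear v : bihom (1, 1) (lin_rel v).
Proof.
rewrite /lin_rel; case: ifP => _; last by move=> m; rewrite mcoeff0 eqxx.
have -> : (1 : int, 1 : int) = (1, 0 : int) + (0, 1 : int) by [].
by apply: bihomD; [|apply: bihomN]; apply: bihomM; (exact: bihom_xX || exact: bihom_nf).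
Qed.

Lemma theta_nf m : theta (nf m) = \sum_q lam m q *: w q.
Proof. by rewrite (rmorph_sum theta) /=; apply: eq_bigr => q _; rewrite thetaZ theta_y. Qed.

Lemma theta_span a : span a -> I (theta a).
Proof.
move=> [h ->]; rewrite rmorph_sum; apply: is_ideal_sum => // -[m [i j]] _.
rewrite rmorphM; apply: is_idealMl => //; rewrite /lin_rel /=.
case: eqP => mD; last by rewrite rmorph0; apply: is_ideal0.
rewrite rmorphB !rmorphM /= !theta_xX !theta_nf.
have h1 := lamP (m := (m + U_(j))%MM); rewrite mdegD mdeg1 addn1 in h1.
have h2 := lamP (m := (m + U_(i))%MM); rewrite mdegD mdeg1 addn1 in h2.
have E : 'X_i * 'X_[m + U_(j)] = 'X_j * 'X_[m + U_(i)] :> S.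
  by rewrite !mpolyXD; ring.
have := is_idealB idI (is_idealMl idI 'X_j (h2 mD)) (is_idealMl idI 'X_i (h1 mD)).
by congr I; rewrite !mulrBr E; ring.
Qed.

(** A variable common to [u] and [u'] is cancelled by induction on the degree. Otherwise a variable
    [j] of [u'] divides [m], and one relation trades it for a variable [i] of [u], after which [j]
    is common. *)
Lemma span_exchange t u u' m m' : mdeg u = t -> mdeg u' = t -> mdeg m = D -> mdeg m' = D ->
  (u + m = u' + m')%MM -> span (xemb 'X_[u] * nf m - xemb 'X_[u'] * nf m').
Proof.
elim: t u u' m m' => [|t IH] u u' m m' ut u't mD m'D E.
  move/eqP: ut; move/eqP: u't; rewrite !mdeg_eq0 => /eqP u'0 /eqP u0.
  by move: E; rewrite u0 u'0 !add0m => ->; rewrite subrr; apply: span0.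
have nz (v : 'X_{1..n}) : mdeg v = t.+1 -> exists i, (U_(i) <= v)%MM.
  move=> vt; have [/existsP[i hi]|/existsPn h] := boolP [exists i, (U_(i) <= v)%MM]; first by exists i.
  suff v0 : v = 0%MM by rewrite v0 mdeg0 in vt.
  by apply/mnmP => i; have := h i; rewrite lep1mP negbK mnm0E => /eqP.
have peel (v : 'X_{1..n}) i : (U_(i) <= v)%MM -> mdeg v = t.+1 -> v = (v - U_(i) + U_(i))%MM /\ mdeg (v - U_(i)) = t.
  move=> le vt; have Ev := submK le; split=> //.
  by have := congr1 mdeg Ev; rewrite mdegD mdeg1 vt addn1 => -[].
have common (v v' p p' : 'X_{1..n}) i : (U_(i) <= v)%MM -> (U_(i) <= v')%MM -> mdeg v = t.+1 -> mdeg v' = t.+1 ->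
    mdeg p = D -> mdeg p' = D -> (v + p = v' + p')%MM ->
    span (xemb 'X_[v] * nf p - xemb 'X_[v'] * nf p').
  move=> iv iv' vt v't pD p'D Ev.
  have [E1 d1] := peel _ _ iv vt; have [E2 d2] := peel _ _ iv' v't.
  rewrite E1 E2 !mpolyXD !rmorphM /= ![_ * xemb 'X_i]mulrC -!mulrA -mulrBr; apply: spanMl.
  apply: IH => //; apply/mnmP => x; have := congr1 (fun q : 'X_{1..n} => q x) Ev.
  by rewrite {1}E1 {1}E2 !mnmDE; lia.
have [i iu] := nz _ ut; have [j ju'] := nz _ u't.
have [ju|ju] := boolP (U_(j) <= u)%MM; first exact: (common _ _ _ _ j).
have jm : (U_(j) <= m)%MM.
  have := congr1 (fun v : 'X_{1..n} => v j) E; rewrite !mnmDE.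
  move: ju ju'; rewrite !lep1mP; lia.
have [E1 d1] := peel _ _ iu ut.
have E2 := submK jm.
have l_deg : (mdeg (m - U_(j))).+1 = D by have := congr1 mdeg E2; rewrite mdegD mdeg1 addn1 mD.
have lb : (mdeg (m - U_(j)) < D)%N by rewrite -l_deg.
have := span_rel (BMultinom lb, (i, j)); rewrite /lin_rel /= l_deg eqxx E2.
move/(spanMl (xemb 'X_[u - U_(i)])) => h.
have := common (u - U_(i) + U_(j))%MM u' (m - U_(j) + U_(i))%MM m' j.
have -> : (u - U_(i) + U_(j) + (m - U_(j) + U_(i)) = u + m)%MM.
  rewrite -{2}E2 {2}E1; apply/mnmP => x; rewrite !mnmDE; lia.
move=> h'; move: (h' (lem_addl _ _) ju').
rewrite !mdegD !mdeg1 d1 !addn1 l_deg => /(_ erefl u't erefl m'D E)/(spanD h).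
have -> : 'X_[u] = 'X_[u - U_(i)] * 'X_i :> S by rewrite -mpolyXD -E1.
rewrite !mpolyXD !rmorphM /= !xembX; congr f_span; ring.
Qed.

(* Modulo the span of the relations, psi is the k-linear inverse of theta on S_(D+t);
   it is well defined there because of span_exchange. *)
Definition psi (t : nat) (h : S) : A :=
  \sum_(M : 'X_{1..n < (D + t).+1})
     h@_M *: (xemb 'X_[mdivisor t M] * nf (M - mdivisor t M)).

Fact psi_is_linear t : linear (psi t).
Proof.
move=> a p q; rewrite scaler_sumr -big_split /=; apply: eq_bigr => M _.
by rewrite mcoeffD mcoeffZ scalerDl scalerA.
Qed.
HB.instance Definition _ t := GRing.isLinear.Build k S A _ (psi t) (psi_is_linear t).

Lemma psiZ t a p : psi t (a *: p) = a *: psi t p. Proof. exact: (linearZ_LR (psi t)). Qed.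

Lemma psi_sum t (J : Type) (r : seq J) (P : pred J) F :
  psi t (\sum_(j <- r | P j) F j) = \sum_(j <- r | P j) psi t (F j).
Proof. exact: (raddf_sum (psi t)). Qed.

Lemma psiX t M : mdeg M = (D + t)%N ->
  psi t 'X_[M] = xemb 'X_[mdivisor t M] * nf (M - mdivisor t M).
Proof.
move=> MD; have lb : (mdeg M < (D + t).+1)%N by rewrite MD.
rewrite /psi (bigD1 (BMultinom lb)) //= mcoeffX eqxx scale1r big1 ?addr0 // => M' ne.
rewrite mcoeffX; case: eqP => [E|]; last by rewrite scale0r.
by rewrite bmeqP /= E eqxx in ne.
Qed.

Definition nfl (g : S) : A := \sum_(m : 'X_{1..n < D.+1}) g@_m *: nf m.

Lemma homog_bounded d (g : S) : g \is d.-homog ->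
  g = \sum_(m : 'X_{1..n < d.+1} | mdeg m == d) g@_m *: 'X_[m].
Proof.
move=> hg; rewrite {1}(@mpolywE _ _ d.+1 g); last first.
  rewrite msizeE; apply/bigmax_leqP_seq => m mg _.
  by rewrite ltnS (dhomogP _ _ _ hg m mg).
rewrite [RHS]big_mkcond /=; apply: eq_bigr => m _.
by case: ifPn => // /(dhomog_nemf_coeff hg) ->; rewrite scale0r.
Qed.

Lemma psi_mul t u g : mdeg u = t -> g \is D.-homog ->
  span (psi t ('X_[u] * g) - xemb 'X_[u] * nfl g).
Proof.
move=> ut hg.
have -> : nfl g = \sum_(m : 'X_{1..n < D.+1} | mdeg m == D) g@_m *: nf m.
  rewrite [RHS]big_mkcond /=; apply: eq_bigr => m _.
  by case: ifPn => // /(dhomog_nemf_coeff hg) ->; rewrite scale0r.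
rewrite {1}(homog_bounded hg) !mulr_sumr psi_sum -sumrB /=; apply: span_sum => m /eqP mD.
rewrite -!scalerAr psiZ -scalerBr; apply: spanZ.
rewrite -mpolyXD psiX ?mdegD ?ut ?mD 1?addnC //.
have um : (t <= mdeg (u + m))%N by rewrite mdegD ut leq_addr.
apply: (@span_exchange t) => //; first by rewrite mdeg_mdivisor.
- by rewrite mdeg_codivisor // mdegD ut mD; lia.
- by rewrite mdivisorK.
Qed.

Lemma nflE g : nfl g = \sum_q (\sum_(m : 'X_{1..n < D.+1}) g@_m * lam m q) *: yvar q.
Proof.
rewrite /nfl /nf; under eq_bigr => m _ do rewrite scaler_sumr.
rewrite exchange_big /=; apply: eq_bigr => q _; rewrite scaler_suml.
by apply: eq_bigr => m _; rewrite scalerA.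
Qed.

Lemma theta_nfl g : g \is D.-homog ->
  I (g - \sum_q (\sum_(m : 'X_{1..n < D.+1}) g@_m * lam m q) *: w q).
Proof.
move=> hg.
have -> : \sum_q (\sum_(m : 'X_{1..n < D.+1}) g@_m * lam m q) *: w q =
   \sum_(m : 'X_{1..n < D.+1} | mdeg m == D) g@_m *: \sum_q lam m q *: w q.
  rewrite [RHS]big_mkcond /= -[RHS](_ : \sum_(m : 'X_{1..n < D.+1}) g@_m *: \sum_q lam m q *: w q = _); last first.
    apply: eq_bigr => m _.
    by case: ifPn => // /(dhomog_nemf_coeff hg) ->; rewrite scale0r.
  under [RHS]eq_bigr => m _ do rewrite scaler_sumr.
  rewrite exchange_big /=; apply: eq_bigr => q _; rewrite scaler_suml.
  by apply: eq_bigr => m _; rewrite scalerA.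
rewrite {1}(homog_bounded hg) -sumrB; apply: is_ideal_sum => // m /eqP mD.
by rewrite -scalerBr; apply: is_idealZ => //; apply: lamP.
Qed.

Lemma nfl_ideal g : g \is D.-homog -> I g -> nfl g = 0.
Proof.
move=> hg Ig; rewrite nflE big1 // => q _.
have := is_ideal_congr idI (theta_nfl hg) Ig.
by move=> /w_free ->; rewrite scale0r.
Qed.

Lemma nfl_w q : nfl (w q) = yvar q.
Proof.
pose mu q' := \sum_(m : 'X_{1..n < D.+1}) (w q)@_m * lam m q'.
have h := theta_nfl (w_homog q); rewrite -/(mu _) in h.
have E : w q - \sum_q' mu q' *: w q' = \sum_q' ((q' == q)%:R - mu q') *: w q'.
  under [RHS]eq_bigr => i _ do rewrite scalerBl.
  rewrite sumrB; congr (_ - _); rewrite (bigD1 q) //= eqxx scale1r.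
  by rewrite big1 ?addr0 // => i /negbTE ->; rewrite scale0r.
rewrite [X in I X]E in h.
have {}h q' : mu q' = (q' == q)%:R by apply/eqP; rewrite eq_sym -subr_eq0 (w_free h).
rewrite nflE (bigD1 q) //= -/(mu q) h eqxx scale1r big1 ?addr0 // => i ne.
by rewrite -/(mu i) h (negbTE ne) scale0r.
Qed.

(** As the generators have degree at most [D], the degree D + t part of the ideal is spanned by
    monomials of degree [t] times elements of degree [D] of the ideal, and the latter have zero
    normal form because the [w] are independent. *)
Lemma psi_ideal t h : h \is (D + t).-homog -> I h -> span (psi t h).
Proof.
move=> hh /gensI [a E].
have -> : h = \sum_(i < size gens) pihomog mdeg (D + t) (a i * gens`_i).
  by rewrite -(pihomog_dE hh) {1}E linear_sum.
rewrite psi_sum; apply: span_sum => i _ /=.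
have gi : gens`_i \in gens by apply: mem_nth.
have [d [dD hd]] := gens_deg gi.
rewrite (pihomog_mul_gen _ _ hd) psi_sum /=; apply: span_sum => M /eqP MD.
rewrite psiZ; apply: spanZ.
have tM : (t <= mdeg M)%N by lia.
rewrite -(mdivisorK tM) mpolyXD -mulrA.
have hg : 'X_[M - mdivisor t M] * gens`_i \is D.-homog.
  have -> : D = (mdeg (M - mdivisor t M)%MM + d)%N by rewrite mdeg_codivisor //; lia.
  by apply: dhomogM hd; rewrite dhomogX.
have Ig : I ('X_[M - mdivisor t M] * gens`_i).
  apply: is_idealMl => //; apply/gensI; exists (fun j => (j == i)%:R).
  rewrite (bigD1 i) //= eqxx mul1r big1 ?addr0 // => j /negbTE ->; exact: mul0r.
have := psi_mul (mdeg_mdivisor tM) hg.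
by rewrite nfl_ideal // mulr0 subr0.
Qed.

(** Modulo the relations, [psi] sends [g q * w q] to [xemb (g q) * yvar q] and kills the ideal: the
    linear relations generate all relations between the [w]. *)
Lemma linear_presentation t (g : 'I_c -> S) : (forall q, g q \is t.-homog) ->
  I (\sum_q g q * w q) -> span (\sum_q xemb (g q) * yvar q).
Proof.
move=> hg Ih.
have hh : \sum_q g q * w q \is (D + t).-homog.
  by apply: rpred_sum => q _; rewrite addnC; apply: dhomogM.
rewrite -(subKr (psi t (\sum_q g q * w q)) (\sum_q _)); apply: spanD; first exact: psi_ideal.
apply: spanN; rewrite psi_sum -sumrB /=; apply: span_sum => q _.
rewrite {1 2}[g q]mpolyE mulr_suml psi_sum (rmorph_sum xemb) mulr_suml -sumrB big_seq /=.
apply: span_sum => M Mg; rewrite -scalerAl psiZ xembZ -scalerAl -scalerBr; apply: spanZ.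
rewrite -nfl_w; apply: psi_mul => //; exact: (dhomogP _ _ _ (hg q)).
Qed.

Lemma gens_span t (h : S) : h \is (D + t).-homog ->
  exists g : 'I_c -> S, (forall q, g q \is t.-homog) /\ I (h - \sum_q g q * w q).
Proof.
move=> hh; exists (fun q => \sum_(M <- msupp h) (h@_M * lam (M - mdivisor t M)%MM q) *: 'X_[mdivisor t M]).
have tM M : M \in msupp h -> (t <= mdeg M)%N /\ mdeg (M - mdivisor t M) = D.
  move=> Mh; have MD := dhomogP _ _ _ hh M Mh; rewrite mdeg_codivisor MD; lia.
split=> [q|].
  rewrite big_seq; apply: rpred_sum => M /tM[tM' _].
  by apply: rpredZ; rewrite dhomogX /= mdeg_mdivisor.
under eq_bigr => q _ do rewrite mulr_suml.
rewrite exchange_big {1}[h]mpolyE -sumrB big_seq; apply: is_ideal_sum => // M /tM[tM' MD].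
have := is_idealZ idI h@_M (is_idealMl idI 'X_[mdivisor t M] (lamP MD)).
congr I; rewrite mulrBr -mpolyXD mdivisorK // scalerBr; congr (_ - _).
rewrite mulr_sumr scaler_sumr; apply: eq_bigr => q _.
by rewrite -scalerAl -scalerAr scalerA.
Qed.

Hypothesis homI : forall f d, I f -> I (homog_part d f).
Variable l : 'I_n.
Hypothesis l_param : exists s, forall M, mdeg M = s -> exists j g, I j /\ 'X_[M] = j + 'X_l * g.

Notation xl := 'X_(lshift c l).

Lemma ideal_mod_l d (h g : S) : h \is d.+1.-homog -> I (h - 'X_l * g) ->
  exists2 g', g' \is d.-homog & I (h - 'X_l * g').
Proof.
move=> hh hg; exists (pihomog mdeg d g); first exact: pihomogP.
have := homI d.+1 hg; rewrite -[homog_part _ _]/(pihomog mdeg d.+1 _) linearB /= (pihomog_dE hh).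
by rewrite pihomog_mul_linear // dhomogX /= mdeg1.
Qed.

(** A high power of ['X_a] sends [w q] into the ideal plus ['X_l] times a combination of the [w].
    This is a relation between the [w], hence lies in the span, and modulo ['X_l] only the power
    times [yvar q] remains. *)
Lemma lin_rel_cofinite i j : i \notin yset -> j \in yset ->
  exists s (h : rel_type -> A), var_ideal [set lshift c l] ('X_i ^+ s * 'X_j - \sum_v h v * lin_rel v).
Proof.
move=> iY /imsetP[q _ ->]; have {iY}[a ->] : exists a, i = lshift c a.
  rewrite -(splitK i); case: (split i) iY (splitK i) => [a|b] /= iY Ei; first by exists a.
  by rewrite -Ei rshift_yset in iY.
have [s hs] := l_param.
have [|j0 [g0 [Ij E0]]] := hs (U_(a) *+ s)%MM; first by rewrite mdegMn mdeg1 mul1n.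
have ha e : ('X_a ^+ e : S) \is e.-homog.
  by rewrite -[e in e.-homog]mul1n; apply: dhomogMn; rewrite dhomogX /= mdeg1.
(* The exponent s + 1 leaves the cofactor of ['X_l] in degree D + s, at least [D] even for s = 0, so
   that [gens_span] applies to it. *)
have hw : 'X_a ^+ s.+1 * w q \is (D + s).+1.-homog.
  by rewrite -addnS addnC; apply: dhomogM.
have [|g hg Ig] := @ideal_mod_l _ _ ('X_a * w q * g0) hw.
  rewrite exprS mpolyXn E0 (_ : _ - _ = 'X_a * w q * j0); last by ring.
  exact: is_idealMl.
have [g' [hg' Ig']] := gens_span hg.
have := @linear_presentation s.+1 (fun q' => (q' == q)%:R * 'X_a ^+ s.+1 - 'X_l * g' q').
case.
- move=> q'; apply: rpredB.
    by case: (q' == q); rewrite ?mul1r ?mul0r ?rpred0.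
  by rewrite -add1n; apply: dhomogM => //; rewrite dhomogX /= mdeg1.
- under eq_bigr => q' _ do rewrite mulrBl.
  rewrite sumrB (bigD1 q) //= eqxx mul1r big1 ?addr0 => [|q' /negbTE ->]; last by rewrite !mul0r.
  have := is_idealD idI Ig (is_idealMl idI 'X_l Ig'); congr I.
  rewrite mulrBr addrA subrK mulr_sumr; congr (_ - _).
  by apply: eq_bigr => q' _; rewrite mulrA.
move=> h E; exists s.+1, h; rewrite -E.
under eq_bigr => q' _ do rewrite rmorphB /= mulrBl !rmorphM /= xembX.
rewrite sumrB (bigD1 q) //= eqxx rmorph1 mul1r rmorphXn /= xembX big1 ?addr0; last first.
  by move=> q' /negbTE ->; rewrite rmorph0 !mul0r.
rewrite -/(yvar q) opprB addrC subrK; apply: var_ideal_sum => q' _.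
by rewrite -mulrA; apply/var_idealMr/var_idealX; rewrite inE.
Qed.

Let biform t (g : 'I_c -> S) : (forall q, g q \is t.-homog) ->
  bihom (t%:Z, 1) (\sum_q xemb (g q) * yvar q).
Proof.
move=> hg; apply: bihom_sum => q _.
have -> : (t%:Z, 1 : int) = (t%:Z, 0 : int) + (0, 1 : int) by apply: (congr2 pair); rewrite /= ?addr0 ?add0r.
by apply: bihomM; [apply: bihom_xemb | apply: bihom_yvar].
Qed.

Let theta_biform (g : 'I_c -> S) : theta (\sum_q xemb (g q) * yvar q) = \sum_q g q * w q.
Proof. by rewrite rmorph_sum; apply: eq_bigr => q _; rewrite rmorphM /= theta_xemb theta_y. Qed.

(** Written through the [w], [h] has coefficients of degree c + e, and there are [c] variables y:
    this comparison produces the threshold D + c. *)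
Lemma quot_mul_surjective e (h : S) : h \is (D + (c + e)).-homog ->
  exists g, I (h - 'X_l * g).
Proof.
move=> hh; have [g [hg Ig]] := gens_span hh.
have [|g' hg'] := f_span_mod_l lin_rel_bilinear (lshift_yset l) lin_rel_cofinite _ (biform hg).
  by rewrite card_yset leq_addr.
exists (theta g'); have := theta_span hg'; rewrite rmorphB rmorphM /= theta_xX theta_biform.
by move/(is_idealD idI Ig); rewrite addrA subrK.
Qed.

Lemma quot_mul_injective e (h : S) : h \is (D + (c + e)).-homog -> I ('X_l * h) -> I h.
Proof.
move=> hh Ilh; have [g [hg Ig]] := gens_span hh.
have Ilg : I (\sum_q 'X_l * g q * w q).
  have := is_ideal_congr idI _ Ilh; apply.
  have := is_idealMl idI 'X_l Ig; rewrite mulrBr mulr_sumr; congr (I (_ - _)).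
  by apply: eq_bigr => q _; rewrite mulrA.
have hlg q : 'X_l * g q \is (c + e).+1.-homog.
  by rewrite -add1n; apply: dhomogM => //; rewrite dhomogX /= mdeg1.
have := linear_presentation hlg Ilg.
under eq_bigr => q _ do rewrite rmorphM /= xembX -mulrA.
rewrite -mulr_sumr => hs.
have := f_span_cancel_l lin_rel_bilinear (lshift_yset l) lin_rel_cofinite _ (biform hg) hs.
rewrite card_yset leq_addr => /(_ isT)/theta_span; rewrite theta_biform.
by move/(is_idealD idI Ig); rewrite subrK.
Qed.

End LinearPresentation.

(** * Minimal resolutions *)

Section Resolution.
Variables (k : fieldType) (n : nat) (I : {mpoly k[n]} -> Prop).
Notation S := {mpoly k[n]}.
Variables (b : nat -> nat) (a : forall i, 'I_(b i) -> nat).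
Variable M : forall i, 'M[S]_(b i.+1, b i).
Hypothesis res : minimal_graded_free_resolution I a M.

Notation T := {i : nat & 'I_(b i)}.
Notation Gen := (@Tagged nat _ (fun i => 'I_(b i))).

(** This is the quantity j - i bounded by the regularity. In this grading the differential has
    degree 1, the weight of a variable, as [section_acyclic] requires. *)
Definition res_shift (t : T) : int := (a (tagged t))%:Z - (tag t)%:Z.
Definition res_mx (t : T) : seq (T * S) :=
  [seq (Gen p, M (tag t) p (tagged t)) | p <- enum 'I_(b (tag t).+1)].
Definition mdegz (m : 'X_{1..n}) : int := (mdeg m)%:Z.

Lemma mdegzD m1 m2 : mdegz (m1 + m2)%MM = mdegz m1 + mdegz m2.
Proof. by rewrite /mdegz mdegD. Qed.

Lemma mdegz1 i : 1 = mdegz U_(i).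
Proof. by rewrite /mdegz mdeg1. Qed.

Notation bd := (bdry res_mx).

Definition res_row i (u : T -> S) : 'rV[S]_(b i) := \row_p u (Gen p).

Lemma res_bdryE u i (q : 'I_(b i)) : bd u (Gen q) = (res_row i.+1 u *m M i) 0 q.
Proof.
rewrite /bdry big_map big_enum /= mxE; apply: eq_bigr => p _; by rewrite mxE.
Qed.

Lemma res_row_bdry i u : res_row i (bd u) = res_row i.+1 u *m M i.
Proof. by apply/rowP => q; rewrite mxE res_bdryE. Qed.

Lemma res_bdry2 u t : bd (bd u) t = 0.
Proof.
case: res => _ _ _ ex _; case: t => i q; rewrite -[existT _ _ _]/(Gen q) res_bdryE.
rewrite res_row_bdry; have [_ /(_ (ex_intro _ _ erefl)) ->] := ex i (res_row i.+2 u *m M i.+1).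
by rewrite mxE.
Qed.

Lemma res_mx_homog t x : x \in res_mx t ->
  forall m, x.2@_m != 0 -> mdegz m + res_shift t = res_shift x.1 + 1.
Proof.
case: res => _ hM _ _ _; case: t => i q /mapP[p _ ->] m /= nz.
case: (hM i p q) => [E|[le hom]]; first by rewrite E mcoeff0 eqxx in nz.
have := dhomogP _ _ _ hom m; rewrite mcoeff_msupp nz => /(_ isT).
rewrite /mdegz /res_shift /=; lia.
Qed.

(** The only homology of the total complex is S/I over F_0. Preimages are chosen independently for
    each index, infinitely many at once. *)
Lemma res_exact y : (forall t, bd y t = 0) -> (forall q : 'I_(b 0), I (y (Gen q))) ->
  exists u, forall t, y t = bd u t.
Proof.
case: res => -[b0 _] _ gen ex _ hy hI.
have H i : exists v : 'rV[S]_(b i.+1), res_row i y = v *m M i.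
  case: i => [|i]; last first.
    have [h _] := ex i (res_row i.+1 y).
    have [|v hv] := h; last by exists v.
    by rewrite -res_row_bdry; apply/rowP => q; rewrite !mxE hy.
  have lt : (0 < b 0)%N by rewrite b0.
  have [v hv] := (gen _).1 (hI (Ordinal lt)).
  exists v; apply/rowP => q; rewrite mxE hv; congr (y (Gen _)).
  by apply/val_inj => /=; have := ltn_ord q; move: (val q) => x; rewrite [b 0]b0; case: x.
pose v i := projT1 (boolp.cid (H i)).
have hv i : res_row i y = v i *m M i by rewrite /v; case: boolp.cid.
pose u (t : T) : S := match t with existT 0 _ => 0 | existT i.+1 p => v i 0 p end.
exists u; case=> i q; rewrite -[existT _ _ _]/(Gen q) res_bdryE.
have -> : res_row i.+1 u = v i by apply/rowP => p; rewrite mxE.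
by rewrite -hv mxE.
Qed.

Lemma res_bdry_ideal u (q : 'I_(b 0)) : I (bd u (Gen q)).
Proof.
case: res => -[b0 _] _ gen _ _; apply/gen; exists (res_row 1 u) => q'.
rewrite -res_bdryE; congr (bd u (Gen _)); apply/val_inj => /=.
have := ltn_ord q'; have := ltn_ord q; move: (val q) (val q') => x y.
by rewrite [b 0]b0; case: x; case: y.
Qed.

Lemma res_homog0 e (z : T -> S) (q : 'I_(b 0)) : homog_chain mdegz res_shift e%:Z z -> z (Gen q) \is e.-homog.
Proof.
case: res => -[_ a0] _ _ _ _ hz; apply/dhomogP => m; rewrite mcoeff_msupp => /hz.
by rewrite /mdegz /res_shift /= a0; lia.
Qed.

Notation acyclic := (acyclic_mod mdegz res_shift res_mx).

Section Regular.
Variables (l : 'I_n) (e : nat).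
Hypothesis l_inj : forall h, h \is e.-homog -> I ('X_l * h) -> I h.
Hypothesis l_surj : forall h, h \is e.-homog -> exists g, I (h - 'X_l * g).

(** For a cycle [z] modulo ['X_l], [y = bd z / 'X_l] is a cycle whose part over F_0 lies in [I] by
    injectivity, so [y] bounds. Correcting [z] then gives a cycle, which bounds once surjectivity
    has moved its part over F_0 into [I]. *)
Lemma res_acyclic_l : acyclic (l |: set0) e%:Z.
Proof.
move=> z hz cz; pose y t := mdiv l (bd z t).
have zy t : bd z t = 'X_l * y t.
  by apply/eqP; rewrite -subr_eq0; apply/eqP/var_ideal_set0/var_ideal_mdiv/cz.
have l0 : 'X_l != 0 :> S by rewrite -msize_poly_eq0 msizeX.
have hy : homog_chain mdegz res_shift e%:Z y.
  apply: (homog_mdiv mdegzD); rewrite -mdegz1; exact: (bdry_homog mdegzD res_mx_homog).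
have by0 t : bd y t = 0.
  apply: (mulfI l0); rewrite mulr0 -bdryM -(res_bdry2 z t); apply: eq_bdry => s.
  by rewrite zy.
have [v hv] : exists v, forall t, y t = bd v t.
  apply: res_exact => // q; apply: l_inj; first exact: res_homog0.
  by rewrite -zy; apply: res_bdry_ideal.
have /boolp.choice[g hg] : forall q : 'I_(b 0), exists g, I (z (Gen q) - 'X_l * g).
  by move=> q; apply/l_surj/res_homog0.
(* Values over F_0 do not enter any boundary, so [v] may be redefined there by the [g] coming from
   [l_surj]. *)
pose v' (t : T) : S := match t with existT 0 q => g q | existT i.+1 p => v (Gen p) end.
have bv' t : bd v' t = bd v t.
  case: t => i q; rewrite -[existT _ _ _]/(Gen q) !res_bdryE.
  suff -> : res_row i.+1 v' = res_row i.+1 v by [].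
  by apply/rowP => p; rewrite !mxE.
have [|q|u hu] := @res_exact (fun t => z t - 'X_l * v' t).
- by move=> t; rewrite bdryB bdryM bv' -hv zy subrr.
- exact: hg.
exists u => t; rewrite -hu subKr; apply/var_idealMr/var_idealX.
by rewrite !inE eqxx.
Qed.

End Regular.

Lemma res_acyclic_all l e : acyclic (l |: set0) e -> acyclic setT e.
Proof.
move=> h; have H (s : seq 'I_n) : acyclic ([set x in s] :|: (l |: set0)) e.
  elim: s => [|x s IH].
    by rewrite (_ : [set x in [::]] = set0) ?set0U //; apply/setP => y; rewrite !inE.
  rewrite set_cons -setUA; have [xs|xs] := boolP (x \in [set x in s] :|: (l |: set0)).
    by rewrite (setUidPr _) // sub1set.
  by apply: (section_acyclic mdegzD res_mx_homog res_bdry2 xs _ IH); apply: mdegz1.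
have := H (enum 'I_n); congr (acyclic _ _).
by apply/setP => x; rewrite !inE mem_enum.
Qed.

(** By minimality every boundary has entries in the irrelevant ideal. A basis element of shift [e]
    is thus a cycle modulo that ideal, and if it bounded there, 1 would lie in the ideal. *)
Lemma res_acyclic_degree e i (p : 'I_(b i)) : acyclic setT e%:Z -> a p <> (e + i)%N.
Proof.
move=> ac aE; pose z (t : T) : S := (t == Gen p)%:R.
have J0 (x : S) : x@_0%MM = 0 -> var_ideal setT x.
  move=> x0 m hm; rewrite (_ : m = 0%MM) //; apply/mnmP => j.
  by rewrite mnm0E hm ?inE.
have bJ u t : var_ideal setT (bd u t).
  case: res => _ _ _ _ M0; rewrite /bdry big_map; apply: var_ideal_sum => p' _ /=.
  by apply/var_idealMl/J0/M0.
have hz : homog_chain mdegz res_shift e%:Z z.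
  move=> t m; rewrite /z; case: (t =P _) => [->|_]; last by rewrite mcoeff0 eqxx.
  rewrite mcoeff1; case: (m =P _) => [-> _|]; last by rewrite eqxx.
  by rewrite /mdegz /res_shift /= mdeg0 aE; lia.
have [u hu] := ac z hz (bJ z).
have := var_idealD (hu (Gen p)) (bJ u (Gen p)); rewrite subrK /z eqxx => /(_ 0%MM).
rewrite mcoeff1 eqxx => /(_ _)/eqP; rewrite oner_eq0 => h; suff : false by [].
by apply: h => j _; rewrite mnm0E.
Qed.

End Resolution.

(** * Linear parameters *)

Lemma zorn_union (T : Type) (P : (T -> Prop) -> Prop) :
  (forall F : (T -> Prop) -> Prop, (forall X, F X -> P X) ->
     (forall X Y, F X -> F Y -> (forall x, X x -> Y x) \/ (forall x, Y x -> X x)) ->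
     P (fun x => exists2 X, F X & X x)) ->
  exists A, P A /\ forall B, P B -> (forall x, A x -> B x) -> forall x, B x -> A x.
Proof.
move=> h; have [|A [PA Amax]] := @classical_sets.Zorn_bigcup T P.
  by move=> F FP Ftot; apply: h => // X Y; apply: Ftot.
exists A; split=> // B PB AB; apply: boolp.contrapT => nBA.
by apply: (Amax B) PB; split.
Qed.

Lemma finite_roots (k : fieldType) (p : {poly k}) : p != 0 -> exists s : seq k, forall x, root p x -> x \in s.
Proof.
have [m] := ubnP (size p); elim: m p => // m IH p pm p0.
have [[x rx]|nr] := boolp.pselect (exists x, root p x); last first.
  by exists [::] => x rx; case: nr; exists x.
have [q E] := factor_theorem p x rx.
have q0 : q != 0 by apply: contraNneq p0 => q0; rewrite E q0 mul0r.
have [|s hs] := IH q _ q0.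
  by apply: leq_trans (pm : (size p <= m)%N); rewrite E size_Mmonic ?monicXsubC // size_XsubC addn2.
exists (x :: s) => y; rewrite E rootM root_XsubC inE => /orP[/hs ->|->]; by rewrite ?orbT.
Qed.

Section HomogeneousIdeals.
Variables (k : fieldType) (n : nat).
Notation S := {mpoly k[n]}.
Implicit Types (J A : S -> Prop) (l a h : S).

(* m^s is contained in J + (l) *)
Definition param_mod (s : nat) J l : Prop :=
  forall M, mdeg M = s -> exists j g, J j /\ 'X_[M] = j + l * g.

Lemma param_mod_leq s s' J l : is_ideal J -> (s <= s')%N -> param_mod s J l -> param_mod s' J l.
Proof.
move=> idJ ss' h M Ms'; have sM : (s <= mdeg M)%N by rewrite Ms'.
have [j [g [Jj E]]] := h _ (mdeg_mdivisor sM).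
exists (j * 'X_[M - mdivisor s M]), (g * 'X_[M - mdivisor s M]); split; first exact: (is_idealMr idJ).
by rewrite -{1}(mdivisorK sM) mpolyXD E; ring.
Qed.

Definition monomials s : seq 'X_{1..n} :=
  [seq val m | m <- [seq m : 'X_{1..n < s.+1} <- enum {: 'X_{1..n < s.+1}} | mdeg m == s]].

Lemma mem_monomials s M : (M \in monomials s) = (mdeg M == s).
Proof.
apply/mapP/eqP => [[m]|Ms]; first by rewrite mem_filter => /andP[/eqP ms _] ->.
have lb : (mdeg M < s.+1)%N by rewrite Ms.
by exists (BMultinom lb) => //=; rewrite mem_filter /= Ms eqxx mem_enum.
Qed.

Lemma monomials_uniq s : uniq (monomials s).
Proof. by rewrite map_inj_uniq ?filter_uniq -?enumT ?enum_uniq // => x y /val_inj. Qed.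

Lemma homog_monomials s (p : S) : p \is s.-homog ->
  p = \sum_(i < size (monomials s)) p@_(nth 0%MM (monomials s) i) *: 'X_[nth 0%MM (monomials s) i].
Proof.
move=> hp; apply/mpolyP => m; rewrite raddf_sum /=.
have [ms|ms] := boolP (m \in monomials s); last first.
  rewrite big1 => [|i _].
    by apply: (dhomog_nemf_coeff hp); rewrite -mem_monomials.
  rewrite mcoeffZ mcoeffX; case: (_ =P m) => [E|]; last by rewrite mulr0.
  by rewrite -E mem_nth in ms.
have lt : (index m (monomials s) < size (monomials s))%N by rewrite index_mem.
rewrite (bigD1 (Ordinal lt)) //= nth_index // mcoeffZ mcoeffX eqxx mulr1 big1 ?addr0 // => i ne.
rewrite mcoeffZ mcoeffX; case: (_ =P m) => [E|]; last by rewrite mulr0.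
case/eqP: ne; apply/val_inj => /=.
by rewrite -E index_uniq // monomials_uniq.
Qed.

(* Writing the degree-(s+1) monomials as X = j + l g, one gets
   (1 + t C) X = j + (l + t l') g for a scalar matrix C, invertible for almost all t. *)
Lemma param_mod_perturb s J l l' : homogeneous_ideal J -> l \is 1.-homog -> l' \is 1.-homog ->
  param_mod s.+1 J l -> exists bad : seq k, forall t, t \notin bad -> param_mod s.+1 J (l + t *: l').
Proof.
move=> [idJ hJ] hl hl' par.
pose N := size (monomials s.+1); pose E (i : 'I_N) := nth 0%MM (monomials s.+1) i.
have Es i : mdeg (E i) = s.+1 by apply/eqP; rewrite -mem_monomials mem_nth.
have H i : exists g, g \is s.-homog /\ J ('X_[E i] - l * g).
  have [j [g [Jj Ej]]] := par _ (Es i).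
  exists (pihomog mdeg s g); split; first exact: pihomogP.
  rewrite -(pihomog_mul_linear _ _ hl) -(@pihomog_dE _ _ mdeg s.+1 'X_[E i]) ?dhomogX /= ?Es //.
  by rewrite -linearB /=; apply: hJ; rewrite Ej addrK.
have /boolp.choice[g hg] := H.
pose C : 'M[k]_N := \matrix_(i, j) (l' * g i)@_(E j).
have EC i : l' * g i = \sum_j C i j *: 'X_[E j].
  have hlg : l' * g i \is s.+1.-homog by rewrite -add1n; apply: dhomogM => //; case: (hg i).
  by rewrite {1}(homog_monomials hlg); apply: eq_bigr => j _; rewrite mxE.
pose P := \det (1%:M + 'X *: map_mx polyC C).
have PE t : P.[t] = \det (1%:M + t *: C).
  rewrite -horner_evalE -det_map_mx; congr (\det _); apply/matrixP => i j.
  rewrite !mxE /= horner_evalE hornerD hornerM hornerX hornerC; congr (_ + _).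
  by case: (i == j); rewrite ?mulr1n ?mulr0n ?hornerC ?horner0.
have P0 : P != 0.
  apply/eqP => P0; have := PE 0; rewrite P0 horner0 scale0r addr0 det1 => /esym/eqP.
  by rewrite oner_eq0.
have [bad hbad] := finite_roots P0; exists bad => t tbad M Ms.
have Q : 1%:M + t *: C \in unitmx.
  by rewrite unitmxE unitfE -PE; apply: contraNN tbad => /eqP h; apply/hbad/eqP.
pose Qi := invmx (1%:M + t *: C).
have J1 i : J (\sum_j (1%:M + t *: C) i j *: 'X_[E j] - (l + t *: l') * g i).
  have [_ Ji] := hg i; move: Ji; congr J.
  have -> : \sum_j (1%:M + t *: C) i j *: 'X_[E j] = 'X_[E i] + t *: (l' * g i) :> S.
    rewrite EC scaler_sumr; under eq_bigr => j _ do rewrite !mxE scalerDl -scalerA.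
    rewrite big_split /=; congr (_ + _); last by apply: eq_bigr => j _; rewrite mxE.
    rewrite (bigD1 i) //= eqxx scale1r big1 ?addr0 // => j ne.
    by rewrite eq_sym (negbTE ne) scale0r.
  by rewrite mulrDl -scalerAl opprD addrACA subrr addr0.
have Mm : M \in monomials s.+1 by rewrite mem_monomials Ms.
have lt : (index M (monomials s.+1) < N)%N by rewrite index_mem.
pose i0 := Ordinal lt.
have EM : E i0 = M by rewrite /E nth_index.
pose G := \sum_i Qi i0 i *: g i.
exists ('X_[M] - (l + t *: l') * G), G; split; last by rewrite subrK.
have -> : 'X_[M] = \sum_i Qi i0 i *: \sum_j (1%:M + t *: C) i j *: 'X_[E j] :> S.
  under eq_bigr => i _ do rewrite scaler_sumr; rewrite exchange_big /=.
  transitivity (\sum_j (Qi *m (1%:M + t *: C)) i0 j *: 'X_[E j] : S).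
    rewrite mulVmx // (bigD1 i0) //= mxE eqxx scale1r EM big1 ?addr0 // => j ne.
    by rewrite mxE eq_sym (negbTE ne) scale0r.
  apply: eq_bigr => j _; rewrite mxE scaler_suml; apply: eq_bigr => i _.
  by rewrite scalerA.
rewrite mulr_sumr -sumrB; apply: (is_ideal_sum idJ) => i _.
by rewrite -scalerAr -scalerBr; apply: (is_idealZ idJ).
Qed.

(** For almost all [t], [l1 + t *: l2] is a parameter for [J1], and [l2 + t^-1 *: l1], the same form
    up to the unit [t], is one for [J2]. *)
Lemma common_parameter (k_infinite : forall s : seq k, exists x : k, x \notin s) J1 J2 :
  homogeneous_ideal J1 -> homogeneous_ideal J2 ->
  (exists l s, l \is 1.-homog /\ param_mod s J1 l) ->
  (exists l s, l \is 1.-homog /\ param_mod s J2 l) ->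
  exists l s, [/\ l \is 1.-homog, param_mod s J1 l & param_mod s J2 l].
Proof.
move=> h1 h2 [l1 [s1 [hl1 p1]]] [l2 [s2 [hl2 p2]]].
pose s := maxn s1 s2.
have q1 : param_mod s.+1 J1 l1 by apply: param_mod_leq p1; [case: h1 | rewrite leqW ?leq_maxl].
have q2 : param_mod s.+1 J2 l2 by apply: param_mod_leq p2; [case: h2 | rewrite leqW ?leq_maxr].
have [b1 hb1] := param_mod_perturb h1 hl1 hl2 q1.
have [b2 hb2] := param_mod_perturb h2 hl2 hl1 q2.
have [t] := k_infinite (0 :: b1 ++ map (fun x => x^-1) b2).
rewrite inE mem_cat !negb_or => /and3P[t0 tb1 tb2].
exists (l1 + t *: l2), s.+1; split; [by apply: rpredD => //; apply: rpredZ|exact: hb1|].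
have /hb2 h : t^-1 \notin b2.
  by apply: contraNN tb2 => tb; apply/mapP; exists t^-1; rewrite ?invrK.
move=> M /h[j [g [Jj E]]]; exists j, (t^-1 *: g); split=> //.
by rewrite E; congr (_ + _); rewrite -scalerAr scalerAl scalerDr scalerA mulVf // scale1r addrC.
Qed.

Definition adjoin J a (f : S) := exists h, J (f - h * a).

Lemma adjoin_ideal J d a : homogeneous_ideal J -> a \is d.-homog -> homogeneous_ideal (adjoin J a).
Proof.
move=> [idJ hJ] ha; split; first split.
- by exists 0; rewrite mul0r subr0; apply: (is_ideal0 idJ).
- move=> f g [h hf] [h' hg]; exists (h + h').
  by have := is_idealD idJ hf hg; congr J; ring.
- move=> f g [h hg]; exists (f * h); have := is_idealMl idJ f hg; congr J; ring.
move=> f e [h hf]; exists (\sum_(M <- msupp h | (mdeg M + d)%N == e) h@_M *: 'X_[M]).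
have := hJ _ e hf; rewrite -[homog_part _ _]/(pihomog mdeg e _) linearB /=.
rewrite (pihomog_mul_gen _ _ ha) mulr_suml; congr (J (_ - _)).
by apply: eq_bigr => M _; rewrite scalerAl.
Qed.

Lemma adjoin_sub J a f : J f -> adjoin J a f.
Proof. by move=> Jf; exists 0; rewrite mul0r subr0. Qed.

Lemma adjoin_mem J a : is_ideal J -> adjoin J a a.
Proof. by move=> idJ; exists 1; rewrite mul1r subrr; apply: (is_ideal0 idJ). Qed.

(** The top degree part of a product is the product of the top parts, so one of these lies in [A];
    subtracting it lowers the total size. *)
Lemma homog_prime A : homogeneous_ideal A -> ~ A 1 ->
  (forall d e a b, a \is d.-homog -> b \is e.-homog -> A (a * b) -> A a \/ A b) ->
  prime_ideal A.
Proof.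
move=> [idA hA] A1 hprime; split=> // a b.
have [N] := ubnP (msize a + msize b); elim: N a b => // N IH a b abN Aab.
have [->|a0] := eqVneq a 0; first by left; apply: (is_ideal0 idA).
have [->|b0] := eqVneq b 0; first by right; apply: (is_ideal0 idA).
pose top (p : S) := pihomog mdeg (msize p).-1 p.
have top_homog p : top p \is (msize p).-1.-homog by apply: pihomogP.
have top_small p : p != 0 -> (msize (p - top p) < msize p)%N.
  move=> p0; have sp : (0 < msize p)%N by rewrite lt0n msize_poly_eq0.
  rewrite -(prednK sp) ltnS msizeE; apply/bigmax_leqP_seq => m mp _.
  move: mp; rewrite mcoeff_msupp mcoeffB mcoeff_pihomog; case: (mdeg m =P _) => [_|/eqP ne]; first by rewrite subrr eqxx.
  rewrite subr0 -mcoeff_msupp => /msize_mdeg_lt; rewrite -{1}(prednK sp) ltnS leq_eqVlt.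
  by rewrite (negbTE ne).
have E : pihomog mdeg ((msize a).-1 + (msize b).-1) (a * b) = top a * top b.
  apply/mpolyP => m; rewrite mcoeff_pihomog; case: eqP => [md|/eqP md]; last first.
    by rewrite (dhomog_nemf_coeff (dhomogM (top_homog a) (top_homog b)) md).
  rewrite !mcoeffM; apply: eq_bigr => j /eqP mj; rewrite !mcoeff_pihomog.
  have dm : (mdeg j.1 + mdeg j.2 = (msize a).-1 + (msize b).-1)%N.
    by apply: etrans md; rewrite [RHS](congr1 mdeg mj) mdegD.
  have vanish (p : S) m' : ((msize p).-1 < mdeg m')%N -> p@_m' = 0.
    move=> lt; apply/memN_msupp_eq0/msize_mdeg_ge; lia.
  case: eqP => [e1|/eqP n1].
    by case: eqP => // /eqP n2; move: dm n2; rewrite e1 => /addnI ->; rewrite eqxx.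
  rewrite mul0r; case: (ltngtP (mdeg j.1) (msize a).-1) n1 => // lt _.
    by rewrite (vanish b) ?mulr0 // -(ltn_add2l (mdeg j.1)) dm ltn_add2r.
  by rewrite (vanish a) ?mul0r.
have := hA _ ((msize a).-1 + (msize b).-1)%N Aab; rewrite -[homog_part _ _]/(pihomog mdeg _ _) E.
case/(hprime _ _ _ _ (top_homog a) (top_homog b)) => At.
  case: (IH (a - top a) b); last by right.
  - by rewrite -ltnS; apply: leq_trans abN; rewrite !ltnS ltn_add2r top_small.
  - by rewrite mulrBl; apply: (is_idealB idA) => //; apply: (is_idealMr idA).
  - by move=> h; left; have := is_idealD idA h At; rewrite subrK.
case: (IH a (b - top b)); first by rewrite -ltnS; apply: leq_trans abN; rewrite !ltnS ltn_add2l top_small.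
- by rewrite mulrBr; apply: (is_idealB idA) => //; apply: (is_idealMl idA).
- by left.
- by move=> h; right; have := is_idealD idA h At; rewrite subrK.
Qed.

Section MaximalNonParam.
(** Two families are used below: all linear forms, and 0 alone, for which having a parameter means
    containing a power of the irrelevant ideal. *)
Variable Lf : S -> Prop.
Hypothesis Lf0 : Lf 0.
Notation has_param J := (exists l s, Lf l /\ param_mod s J l).
Hypothesis Lf_common : forall J1 J2, homogeneous_ideal J1 -> homogeneous_ideal J2 ->
  has_param J1 -> has_param J2 ->
  exists l s, [/\ Lf l, param_mod s J1 l & param_mod s J2 l].

(* a homogeneous ideal maximal among those without parameter in Lf is prime *)
Lemma prime_without_param J0 : homogeneous_ideal J0 -> ~ has_param J0 ->
  exists A, [/\ homogeneous_ideal A, prime_ideal A, (forall f, J0 f -> A f) & ~ has_param A].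
Proof.
move=> hJ0 bad0.
pose Q A := [/\ homogeneous_ideal A, (forall f, J0 f -> A f) & ~ has_param A].
have [F FP Ftot|A [PA Amax]] := @zorn_union S (fun X => Q X \/ forall x, ~ X x).
  have [[X0 [FX0 [x0 Xx0]]]|none] := boolp.pselect (exists X, F X /\ exists x, X x); last first.
    by right => x [X FX Xx]; apply: none; exists X; split=> //; exists x.
  have FQ X x : F X -> X x -> Q X by move=> FX Xx; case: (FP X FX) => // /(_ x).
  left; have [[id0 hom0] sub0 _] := FQ _ _ FX0 Xx0.
  have merge (f g : S) X Y : F X -> X f -> F Y -> Y g -> exists Z, [/\ F Z, Z f, Z g & Q Z].
    move=> FX Xf FY Yg; case: (Ftot X Y FX FY) => sub.
      by exists Y; split=> //; [apply: sub|apply: FQ FY Yg].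
    by exists X; split=> //; [apply: sub|apply: FQ FX Xf].
  split.
  - split; first split.
    + by exists X0 => //; apply: (is_ideal0 id0).
    + move=> f g [X FX Xf] [Y FY Yg]; have [Z [FZ Zf Zg [[idZ _] _ _]]] := merge _ _ _ _ FX Xf FY Yg.
      by exists Z => //; apply: (is_idealD idZ).
    + move=> f g [X FX Xg]; have [[idX _] _ _] := FQ _ _ FX Xg.
      by exists X => //; apply: (is_idealMl idX).
    + move=> f d [X FX Xf]; have [[_ homX] _ _] := FQ _ _ FX Xf.
      by exists X => //; apply: homX.
  - by move=> f /sub0 X0f; exists X0.
  - move=> [l [s [Ll par]]].
    (* A parameter of the union involves one element for each of the finitely many monomials of
       degree [s], hence is already a parameter of one member of the chain. *)
    have [X [FX QX hX]] : exists X, [/\ F X, Q X & forall M, M \in monomials s -> exists j g, X j /\ 'X_[M] = j + l * g].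
      have : {subset monomials s <= monomials s} by [].
      elim: {1 3}(monomials s) => [|M r IH] sub; first by exists X0; split=> //; apply: FQ Xx0.
      have [|X [FX QX hX]] := IH; first by move=> M' M'r; apply: sub; rewrite inE M'r orbT.
      have Ms : mdeg M = s by apply/eqP; rewrite -mem_monomials sub // inE eqxx.
      have [j [g [[Y FY Yj] E]]] := par M Ms.
      have zX : X 0 by case: QX => [[idX _] _ _]; apply: (is_ideal0 idX).
      case: (Ftot X Y FX FY) => [XY|YX].
        exists Y; split=> //; first exact: FQ Yj.
        move=> M'; rewrite inE => /orP[/eqP ->|/hX[j' [g' [Xj' E']]]]; first by exists j, g.
        by exists j', g'; split=> //; apply: XY.
      exists X; split=> // M'; rewrite inE => /orP[/eqP ->|/hX //].
      by exists j, g; split=> //; apply: YX.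
    case: QX => _ _; apply; exists l, s; split=> // M Ms; apply: hX.
    by rewrite mem_monomials Ms.
have {PA} QA : Q A.
  case: PA => // Aempty; case: (Aempty 0); apply: (Amax J0); first by left; split.
    by move=> x /Aempty.
  by case: hJ0 => id0 _; apply: (is_ideal0 id0).
have [[idA homA] subA badA] := QA.
have A1 : ~ A 1.
  move=> A1; apply: badA; exists 0, 0%N; split=> // M _; exists 'X_[M], 0.
  by rewrite mul0r addr0; split=> //; rewrite -['X_[M]]mulr1; apply: (is_idealMl idA).
exists A; split=> //; apply: homog_prime => // d e a b ha hb Aab.
apply: boolp.contrapT => /boolp.not_orP[Aa Ab].
have good c0 f : f \is c0.-homog -> ~ A f -> has_param (adjoin A f).
  move=> hf Af; apply: boolp.contrapT => nopar; apply: Af.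
  apply: (Amax (adjoin A f)); last exact: adjoin_mem.
    left; split=> //; first exact: (@adjoin_ideal _ c0).
    by move=> x /subA; apply: adjoin_sub.
  by move=> x; apply: adjoin_sub.
have [l [s [Ll p1 p2]]] := Lf_common (adjoin_ideal (conj idA homA) ha) (adjoin_ideal (conj idA homA) hb)
  (good _ _ ha Aa) (good _ _ hb Ab).
(* [M] is split into two monomials of degree [s], one expressed modulo [adjoin A a], the other
   modulo [adjoin A b]; the product of the two ideal terms lies in [A] since [a * b] does. *)
apply: badA; exists l, (s + s)%N; split=> // M Ms.
have sM : (s <= mdeg M)%N by rewrite Ms leq_addr.
have [j [g [[h1 Ah1] E1]]] := p1 _ (mdeg_mdivisor sM).
have [|j' [g' [[h2 Ah2] E2]]] := p2 (M - mdivisor s M)%MM; first by rewrite mdeg_codivisor // Ms addnK.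
exists (j * j'), (g * j' + j * g' + l * (g * g')); split; last first.
  rewrite -{1}(mdivisorK sM) mpolyXD E1 E2; ring.
have -> : j * j' = (j - h1 * a) * j' + h1 * a * (j' - h2 * b) + h1 * h2 * (a * b) by ring.
apply: (is_idealD idA); last exact: (is_idealMl idA).
by apply: (is_idealD idA); [apply: (is_idealMr idA)|apply: (is_idealMl idA)].
Qed.

End MaximalNonParam.

Lemma param_variables J : (forall i, J 'X_i) -> is_ideal J -> param_mod 1 J 0.
Proof.
move=> h idJ M /eqP/mdeg1P[i /eqP ->]; exists 'X_i, 0; split=> //.
by rewrite mul0r addr0.
Qed.

Lemma irrelevant_ideal_prime : prime_ideal (fun f : S => f@_0%MM = 0).
Proof.
split.
- split; first by rewrite mcoeff0.
    by move=> f g f0 g0; rewrite mcoeffD f0 g0 addr0.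
  by move=> f g g0; rewrite (rmorphM (mcoeff 0%MM)) /= g0 mulr0.
- by rewrite mcoeff1 eqxx => /eqP; rewrite oner_eq0.
move=> a b; rewrite (rmorphM (mcoeff 0%MM)) /= => /eqP; rewrite mulf_eq0.
by case/orP => /eqP; [left|right].
Qed.

(** Without a linear parameter there are three primes in a chain: [P0] maximal over [I] without
    linear parameter, [P1] maximal over [P0] and a variable without power of the irrelevant ideal,
    and the irrelevant ideal itself. *)
Lemma linear_parameter_exists (k_infinite : forall s : seq k, exists x : k, x \notin s) I :
  homogeneous_ideal I -> krull_dim_quot_le1 I ->
  exists l s, l \is 1.-homog /\ param_mod s I l.
Proof.
move=> hI dimI; apply: boolp.contrapT => bad; apply: dimI.
have [||P0 [homP0 primeP0 IP0 bad0]] := @prime_without_param (fun l => l \is 1.-homog) _ _ I hI bad.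
- exact: rpred0.
- by move=> J1 J2 h1 h2; apply: common_parameter.
have nX J : is_ideal J -> ~ param_mod 1 J 0 -> exists i, ~ J 'X_i.
  move=> idJ np; apply: boolp.contrapT => h; apply/np/param_variables => // i.
  by apply: boolp.contrapT => Ji; apply: h; exists i.
have [|i Xi] := nX P0 (proj1 homP0).
  by move=> par; apply: bad0; exists 0, 1%N; split=> //; apply: rpred0.
have hXi : ('X_i : S) \is 1.-homog by rewrite dhomogX /= mdeg1.
have homJ := adjoin_ideal homP0 hXi.
have [||||P1 [homP1 primeP1 JP1 bad1]] := @prime_without_param (fun l => l = 0) _ _ (adjoin P0 'X_i).
- by [].
- move=> J1 J2 [id1 _] [id2 _] [_ [s1 [-> p1]]] [_ [s2 [-> p2]]].
  exists 0, (maxn s1 s2); split=> //.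
    by apply: param_mod_leq p1 => //; apply: leq_maxl.
  by apply: param_mod_leq p2 => //; apply: leq_maxr.
- exact: homJ.
(* If [P0] and ['X_i] generated an ideal containing a power of the irrelevant ideal, ['X_i] would be
   a linear parameter for [P0]. *)
- move=> [_ [s [-> p]]]; apply: bad0; exists 'X_i, s; split=> // M /p[j [g [[h P0h] ->]]].
  by exists (j - h * 'X_i), h; split=> //; rewrite mul0r addr0 mulrC subrK.
have [i1 Xi1] : exists i1, ~ P1 'X_i1.
  by apply: nX (proj1 homP1) _ => par; apply: bad1; exists 0, 1%N.
exists P0, P1, (fun f => f@_0%MM = 0); split=> //.
- by split=> //; split=> //; apply: irrelevant_ideal_prime.
- split; first by move=> f P0f; apply/JP1/adjoin_sub.
  by exists 'X_i; split=> //; apply/JP1/adjoin_mem; case: homP0.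
split; last first.
  by exists 'X_i1; split=> //; rewrite mcoeffX mnm1_eq0.
(* By homogeneity [P1] contains the constant term of [f], which must vanish because [P1] is
   proper. *)
move=> f P1f; have [idP1 hP1] := homP1; have := hP1 f 0%N P1f.
rewrite -[homog_part _ _]/(pihomog mdeg 0 f) pihomog_0.
move=> h; apply/eqP/negPn/negP => nz; case: primeP1 => _ P11 _; apply: P11.
have := is_idealMl idP1 ((f@_0%MM)^-1)%:MP h.
by rewrite -mpolyCM mulVf // mpolyC1.
Qed.

End HomogeneousIdeals.

(** * Linear changes of coordinates *)

Section LinearSubstitution.
Variables (k : fieldType) (n : nat).
Notation S := {mpoly k[n]}.
Variable ls : n.-tuple S.
Hypothesis ls_linear : forall i, tnth ls i \is 1.-homog.
Notation sub := (comp_mpoly ls).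

Lemma sub_monomial_homog M : sub 'X_[M] \is (mdeg M).-homog.
Proof.
rewrite comp_mpolyX mdegE.
elim/big_rec2: _ => [|i d p _ hp]; first exact: dhomog1.
by apply: dhomogM => //; have := dhomogMn (M i) (ls_linear i); rewrite mul1n.
Qed.

Lemma sub_pihomog d p : sub (pihomog mdeg d p) = pihomog mdeg d (sub p).
Proof.
have -> : sub p = \sum_(M <- msupp p) p@_M *: sub 'X_[M].
  rewrite {1}[p]mpolyE (rmorph_sum sub) /=; apply: eq_bigr => M _; exact: comp_mpolyZ.
rewrite pihomogE (rmorph_sum sub) (raddf_sum (pihomog mdeg d)) /= big_mkcond /=.
apply: eq_bigr => M _; rewrite comp_mpolyZ linearZ /=; case: eqP => [<-|/eqP ne].
  by rewrite (pihomog_dE (sub_monomial_homog M)).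
by rewrite (pihomog_ne0 _ (sub_monomial_homog M)) ?scaler0 // eq_sym.
Qed.

Lemma sub_homog d p : p \is d.-homog -> sub p \is d.-homog.
Proof. by move=> hp; rewrite homog_piE -sub_pihomog pihomog_dE. Qed.

Lemma sub_mcoeff0 p : p@_0%MM = 0 -> (sub p)@_0%MM = 0.
Proof.
move=> p0; have := sub_pihomog 0 p; rewrite !pihomog_0 p0 mpolyC0 comp_mpoly0.
by move/esym/eqP; rewrite mpolyC_eq0 => /eqP.
Qed.

End LinearSubstitution.

Lemma comp_mpolyK (k : fieldType) n (ls lt : n.-tuple {mpoly k[n]}) :
  (forall i, tnth ls i \mPo lt = 'X_i) -> forall p, (p \mPo ls) \mPo lt = p.
Proof.
move=> h p; rewrite {1 2}[p]mpolyE (rmorph_sum (comp_mpoly ls)) (rmorph_sum (comp_mpoly lt)) /=.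
apply: eq_bigr => M _; rewrite !comp_mpolyZ; congr (_ *: _).
rewrite comp_mpolyX rmorph_prod /= mpolyXE_id; apply: eq_bigr => i _.
by rewrite rmorphXn /= h.
Qed.

(** A variable occurring in [l] is replaced by [l]; the inverse substitution solves
    [l = r + a *: 'X_i] for that variable. *)
Lemma linear_form_coordinates (k : fieldType) n (l : {mpoly k[n]}) : l \is 1.-homog -> l != 0 ->
  exists i (ls lt : n.-tuple {mpoly k[n]}),
   [/\ forall j, tnth ls j \is 1.-homog, forall j, tnth lt j \is 1.-homog, tnth ls i = l,
       forall p, (p \mPo ls) \mPo lt = p & forall p, (p \mPo lt) \mPo ls = p].
Proof.
move=> hl l0; have [M Ml] : exists M, M \in msupp l.
  by exists (mlead l); apply: mlead_supp.
have /eqP/mdeg1P[i /eqP EM] := dhomogP _ _ _ hl M Ml.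
have a0 : l@_U_(i) != 0 by rewrite -EM -mcoeff_msupp.
pose a := l@_U_(i); pose r := l - a *: 'X_i.
have hX j : ('X_j : {mpoly k[n]}) \is 1.-homog by rewrite dhomogX /= mdeg1.
pose ls := [tuple if j == i then l else 'X_j | j < n].
pose lt := [tuple if j == i then a^-1 *: ('X_i - r) else 'X_j | j < n].
(* r does not involve the variable i, hence is fixed by both substitutions *)
have rE (lq : n.-tuple {mpoly k[n]}) : (forall j, j != i -> tnth lq j = 'X_j) -> r \mPo lq = r.
  move=> hq.
  have hr : r = \sum_(j < n | j != i) l@_U_(j) *: 'X_j.
    apply/mpolyP => m; rewrite raddf_sum /r mcoeffB mcoeffZ mcoeffX /=.
    have [/eqP m1|m1] := boolP (mdeg m == 1%N); last first.
      rewrite (dhomog_nemf_coeff hl m1) big1 => [|j _].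
        by case: (_ =P m) => [Em|]; rewrite ?mulr0 ?subr0 //; move: m1; rewrite -Em mdeg1.
      by rewrite mcoeffZ mcoeffX; case: (_ =P m) => [Em|]; rewrite ?mulr0 //; move: m1; rewrite -Em mdeg1.
    have /mdeg1P[j /eqP ->] : mdeg m == 1%N by rewrite m1.
    rewrite eq_mnm1; have [<-|ne] := eqVneq i j.
      rewrite mulr1 subrr big1 // => j' ne'.
      by rewrite mcoeffZ mcoeffX eq_mnm1 (negbTE ne') mulr0.
    rewrite mulr0 subr0 (bigD1 j) 1?eq_sym //= mcoeffZ mcoeffX eqxx mulr1 big1 ?addr0 // => j' /andP[_ ne'].
    by rewrite mcoeffZ mcoeffX eq_mnm1 (negbTE ne') mulr0.
  rewrite hr (rmorph_sum (comp_mpoly lq)); apply: eq_bigr => j ji /=.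
  by rewrite comp_mpolyZ comp_mpolyXU -tnth_nth hq.
have subX j (lq : n.-tuple {mpoly k[n]}) : 'X_j \mPo lq = tnth lq j by rewrite comp_mpolyXU -tnth_nth.
have lsE j : tnth ls j = if j == i then l else 'X_j by rewrite tnth_mktuple.
have ltE j : tnth lt j = if j == i then a^-1 *: ('X_i - r) else 'X_j by rewrite tnth_mktuple.
have lE : l = r + a *: 'X_i by rewrite subrK.
exists i, ls, lt; split.
- by move=> j; rewrite lsE; case: ifP.
- move=> j; rewrite ltE; case: ifP => // _.
  by apply/rpredZ/rpredB => //; apply: rpredB => //; apply: rpredZ.
- by rewrite lsE eqxx.
- apply: comp_mpolyK => j; rewrite lsE; case: (eqVneq j i) => [->|ji]; last by rewrite subX ltE (negbTE ji).
  rewrite {1}lE comp_mpolyD rE => [|j' ne]; last by rewrite ltE (negbTE ne).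
  by rewrite comp_mpolyZ subX ltE eqxx scalerA divff // scale1r addrC subrK.
apply: comp_mpolyK => j; rewrite ltE; case: (eqVneq j i) => [->|ji]; last by rewrite subX lsE (negbTE ji).
rewrite comp_mpolyZ comp_mpolyB rE => [|j' ne]; last by rewrite lsE (negbTE ne).
by rewrite subX lsE eqxx {1}lE addrAC subrr add0r scalerA mulVf // scale1r.
Qed.

(** Coefficients indexed by [nat] avoid a cast when [G] is replaced by its image, whose size is only
    propositionally equal. *)
Lemma generated_byP (k : fieldType) n (I : {mpoly k[n]} -> Prop) G : generated_by I G <->
  forall f, I f <-> exists h : nat -> {mpoly k[n]}, f = \sum_(i < size G) h i * G`_i.
Proof.
have H m (F : nat -> {mpoly k[n]}) f :
   (exists h : 'I_m -> {mpoly k[n]}, f = \sum_(i < m) h i * F i) <->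
   (exists h : nat -> {mpoly k[n]}, f = \sum_(i < m) h i * F i).
  split=> -[h ->]; last by exists (fun i => h i).
  exists (fun i => if insub i is Some x then h x else 0).
  by apply: eq_bigr => i _; rewrite valK.
by split=> E f; rewrite E H.
Qed.

(** * Transport of the ideal, its parameter and its resolution *)

Section Transport.
Variables (k : fieldType) (n : nat) (I : {mpoly k[n]} -> Prop).
Notation S := {mpoly k[n]}.
Variables ls lt : n.-tuple S.
Hypothesis ls_linear : forall i, tnth ls i \is 1.-homog.
Hypothesis lt_linear : forall i, tnth lt i \is 1.-homog.
Notation sg := (comp_mpoly ls).
Notation tu := (comp_mpoly lt).
Hypothesis sgK : forall p, tu (sg p) = p.
Hypothesis tuK : forall p, sg (tu p) = p.

Definition pullback (f : S) := I (sg f).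

Lemma pullback_homogeneous : homogeneous_ideal I -> homogeneous_ideal pullback.
Proof.
move=> [idI hI]; split; first split; rewrite /pullback.
- by rewrite rmorph0; apply: (is_ideal0 idI).
- by move=> f g If Ig; rewrite rmorphD; apply: (is_idealD idI).
- by move=> f g Ig; rewrite rmorphM; apply: (is_idealMl idI).
by move=> f d /(hI _ d); rewrite -[homog_part _ _]/(pihomog mdeg d _) -(sub_pihomog ls_linear).
Qed.

Lemma pullback_generated G : generated_by I G -> generated_by pullback (map tu G).
Proof.
move=> /generated_byP hG; apply/generated_byP => f; rewrite /pullback hG size_map.
split=> -[h E].
  exists (tu \o h); rewrite -[f]sgK E rmorph_sum; apply: eq_bigr => i _.
  by rewrite rmorphM /= (nth_map 0).
exists (sg \o h); rewrite E rmorph_sum; apply: eq_bigr => i _.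
by rewrite rmorphM /= (nth_map 0) // tuK.
Qed.

Lemma pullback_param s l : is_ideal I -> param_mod s I l -> param_mod s pullback (tu l).
Proof.
move=> idI par M Ms.
have [j [g [Ij E]]] : exists j g, I j /\ sg 'X_[M] = j + l * g.
  have hM : sg 'X_[M] \is s.-homog by rewrite -Ms; apply: sub_monomial_homog.
  rewrite (homog_monomials hM); move: (sg 'X_[M]) => p.
  elim/big_rec: _ => [|i q _ [j [g [Ij ->]]]].
    by exists 0, 0; split; [apply: (is_ideal0 idI)|rewrite mulr0 addr0].
  have [|j' [g' [Ij' ->]]] := par (nth 0%MM (monomials n s) i).
    by apply/eqP; rewrite -mem_monomials mem_nth.
  exists (p@_(nth 0%MM (monomials n s) i) *: j' + j), (p@_(nth 0%MM (monomials n s) i) *: g' + g); split.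
    by apply: (is_idealD idI) => //; apply: (is_idealZ idI).
  by rewrite scalerDr mulrDr scalerAr addrACA.
exists (tu j), (tu g); rewrite /pullback tuK; split=> //.
by rewrite -['X_[M]]sgK E rmorphD rmorphM.
Qed.

Lemma pullback_resolution b a M : @minimal_graded_free_resolution k n I b a M ->
  @minimal_graded_free_resolution k n pullback b a (fun i => map_mx tu (M i)).
Proof.
have mK r s (A : 'M[S]_(r, s)) : map_mx tu (map_mx sg A) = A.
  by apply/matrixP => x y; rewrite !mxE sgK.
have Km r s (A : 'M[S]_(r, s)) : map_mx sg (map_mx tu A) = A.
  by apply/matrixP => x y; rewrite !mxE tuK.
case=> h0 hM hI hex hmin; split=> //.
- move=> i p q; rewrite mxE; case: (hM i p q) => [->|[le hom]]; first by left; rewrite rmorph0.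
  by right; split=> //; apply: sub_homog.
- move=> f; rewrite /pullback hI; split=> -[v hv].
    exists (map_mx tu v) => q; rewrite -map_mxM mxE hv; exact: sgK.
  by exists (map_mx sg v) => q; rewrite -(Km _ _ (M 0%N)) -map_mxM mxE hv.
- move=> i w; have [h1 h2] := hex i (map_mx sg w); split=> [E|[v E]].
    have [|v hv] := h1; last by exists (map_mx tu v); rewrite -map_mxM hv mK.
    by rewrite -(Km _ _ (M i)) -map_mxM E map_mx0.
  rewrite -(mK _ _ w) -map_mxM h2 ?map_mx0 //.
  by exists (map_mx sg v); rewrite -E map_mxM Km.
by move=> i p q; rewrite mxE; apply: sub_mcoeff0.
Qed.

End Transport.

(** * Assembly of the regularity bound *)

Lemma resolution_degree_variable (k : fieldType) n (I : {mpoly k[n]} -> Prop) D c s l gens w b a M :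
  homogeneous_ideal I -> generated_by I gens ->
  (forall g, g \in gens -> exists d, (d <= D)%N /\ g \is d.-homog) ->
  (forall q : 'I_c, w q \is D.-homog) ->
  (forall lam : 'I_c -> k, I (\sum_i lam i *: w i) -> forall i, lam i = 0) ->
  (forall g, g \is D.-homog -> exists lam : 'I_c -> k, I (g - \sum_i lam i *: w i)) ->
  param_mod s I 'X_l -> @minimal_graded_free_resolution k n I b a M ->
  forall i p e, a i p <> (D + (c + e) + i)%N.
Proof.
move=> [idI hI] hG gdeg whom wfree wspan par res i p e.
have [lam lamP] := nf_exists wspan.
apply: (res_acyclic_degree res); apply: (@res_acyclic_all _ _ _ _ _ _ res l).
apply: (res_acyclic_l res) => h hh.
  by apply: (quot_mul_injective idI hG gdeg whom wfree lamP hI _ hh); exists s.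
by apply: (quot_mul_surjective idI hG gdeg whom wfree lamP hI _ hh); exists s.
Qed.

Theorem theorem2p1 (k : fieldType) (k_infinite : forall s : seq k, exists x : k, x \notin s)
  (n : nat) (I : {mpoly k[n]} -> Prop) (D c : nat) :
  homogeneous_ideal I ->
  krull_dim_quot_le1 I ->
  generated_in_degrees_le I D ->
  hilbert_fun_quot I D c ->
  reg_quot_le I (D%:Z + c%:Z - 1).
Proof.
move=> hI dimI [gens [hG gdeg]] [w [whom wfree wspan]] i j [b [a [M [res [p <-]]]]].
suff lt : (a i p < D + c + i)%N by lia.
rewrite ltnNge; apply/negP => le.
have ap : a i p = (D + (c + (a i p - (D + c + i))) + i)%N by lia.
move: ap; set e := (a i p - _)%N.
have [n0|n0] := posnP n.
  (* Without variables, acyclicity modulo all variables is exactness. A nonzero component over F_0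
     would be a constant of degree D + c + e, so D = c = 0 and the spanning property puts 1 in
     [I]. *)
  apply: (res_acyclic_degree res) => z hz cz.
  have setT0 : setT = set0 :> {set 'I_n}.
    by apply/setP => -[x ltx]; exfalso; move: ltx; rewrite n0.
  have [||u hu] := @res_exact _ _ _ _ _ _ res z; last 1 first.
  - by exists u => t; rewrite hu subrr; apply: var_ideal0.
  - by move=> t; apply/var_ideal_set0; rewrite -setT0.
  move=> q; have hq := res_homog0 res q hz; move: (z _) hq => h hq.
  have [->|hn0] := eqVneq h 0; first by apply: (is_ideal0 (proj1 hI)).
  have /esym/eqP := dhomog_uniq hn0 (nvar0_homog_eq _ h n0) hq.
  rewrite !addn_eq0 => /and3P[/eqP D0 /eqP c0 _].
  have [|lam] := wspan 1; first by rewrite D0 dhomog1.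
  rewrite big1 ?subr0 => [I1|[x ltx] _]; last by exfalso; move: ltx; rewrite c0.
  by rewrite -[h]mulr1; apply: (is_idealMl (proj1 hI)).
have [l [s [hl l0 par]]] : exists l s, [/\ l \is 1.-homog, l != 0 & param_mod s I l].
  have [l [s [hl par]]] := linear_parameter_exists k_infinite hI dimI.
  (* If 0 is a parameter, [I] contains a power of the irrelevant ideal and any variable is a
     parameter too. *)
  have [l0|l0] := eqVneq l 0; last by exists l, s.
  exists 'X_(Ordinal n0), s; split; first by rewrite dhomogX /= mdeg1.
    by rewrite -msize_poly_eq0 msizeX.
  move=> m /par[j0 [g [Ij ->]]]; exists j0, 0; split=> //.
  by rewrite l0 mul0r mulr0.
have [x [ls [lt [hls hlt lsx sgK tuK]]]] := linear_form_coordinates hl l0.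
have parX : param_mod s (pullback I ls) 'X_x.
  have El : l = 'X_x \mPo ls by rewrite comp_mpolyXU -tnth_nth lsx.
  rewrite -['X_x]sgK -El.
  exact: (pullback_param hls sgK tuK (proj1 hI) par).
apply: (resolution_degree_variable (pullback_homogeneous hls hI) (pullback_generated sgK tuK hG)
  _ (w := fun q => w q \mPo lt) _ _ _ parX (pullback_resolution hlt sgK tuK res)).
- move=> _ /mapP[g /gdeg[d [dD hd]] ->]; exists d; split=> //; exact: sub_homog.
- by move=> q; apply: sub_homog.
- move=> lam Il; apply: wfree; move: Il; rewrite /pullback rmorph_sum /=; congr I.
  by apply: eq_bigr => q _; rewrite !comp_mpolyZ tuK.
move=> g hg; have [lam hlam] := wspan _ (sub_homog hls hg).
exists lam; move: hlam; rewrite /pullback rmorphB rmorph_sum /=; congr (I (_ - _)).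
by apply: eq_bigr => q _; rewrite !comp_mpolyZ tuK.
Qed.
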